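(* Let $Z\in\mathbb{C}^{n\times n}$ be a nonsingular matrix and let $Z=U_pH$ be its polar decomposition. Then $$\min_{Q\in \mathrm{U}(n)}\|\operatorname{Log}(Q^*Z)\|=\min_{Q\in \mathrm{U}(n)}\|\operatorname{sym}_*\operatorname{Log}(Q^*Z)\|=\|\log(U_p^*Z)\|=\|\log H\|$$ holds for every $n\in\mathbb{N}$ when $\|\cdot\|$ is the spectral norm $\|\cdot\|_2$, and for every $n\le 3$ when $\|\cdot\|$ is the Frobenius norm $\|\cdot\|_F$.
   Context: $\mathrm{U}(n)$ is the group of complex unitary $n\times n$ matrices. The polar decomposition of a nonsingular $Z$ is the unique factorization $Z=U_pH$ with $U_p\in\mathrm{U}(n)$ and $H$ Hermitian positive definite. For $X\in\mathbb{C}^{n\times n}$, $\operatorname{sym}_*X=\frac12(X^*+X)$ is the Hermitian part. $\|X\|_2$ is the largest singular value of $X$ and $\|X\|_F=\big(\sum_{i,j}|X_{ij}|^2\big)^{1/2}$. $\operatorname{Log}(M)$ denotes any matrix logarithm of a nonsingular $M$, i.e. any $X\in\mathbb{C}^{n\times n}$ with $\exp X=M$; $\log M$ denotes the principal logarithm (the unique logarithm whose eigenvalues have imaginary part in $(-\pi,\pi)$, defined when $M$ has no eigenvalues in $(-\infty,0]$). The minima are taken over all unitary $Q$ and over all logarithms, that is, $$\min_{Q\in \mathrm{U}(n)}\|\operatorname{Log}(Q^*Z)\|:=\min\{\|X\| : Q\in\mathrm{U}(n),\ X\in\mathbb{C}^{n\times n},\ \exp X=Q^*Z\},$$ $$\min_{Q\in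 \mathrm{U}(n)}\|\operatorname{sym}_*\operatorname{Log}(Q^*Z)\|:=\min\{\|\operatorname{sym}_*X\| : Q\in\mathrm{U}(n),\ X\in\mathbb{C}^{n\times n},\ \exp X=Q^*Z\},$$ and the claim includes that these minima are attained. *)

(* Defs.v *)
From mathcomp Require Import all_boot all_order all_algebra.
From mathcomp Require Import spectral.
From mathcomp Require Import all_classical all_reals topology normedtype.
From mathcomp Require Import sequences trigo complex.

Set Implicit Arguments.
Unset Strict Implicit.
Unset Printing Implicit Defensive.

Import Order.TTheory GRing.Theory Num.Theory.
Import numFieldNormedType.Exports.

Local Open Scope classical_set_scope.
Local Open Scope ring_scope.
Local Open Scope sesquilinear_scope.
Local Open Scope complex_scope.

Definition is_minimum (R : realType) (A : set R) (m : R) : Prop :=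
  A m /\ lbound A m.

(* The limit is taken entrywise (the topology of matrices). For C := R[i] with
   R : realType the series converges for every X, so the default value of limn
   is never used. Keeping C abstract makes the topology inferred from its
   numFieldType structure: R[i] itself has no declared topological instance. *)
Definition expm (C : numFieldType) (n : nat) (X : 'M[C]_n) : 'M[C]_n :=
  limn (series (fun k : nat => (k`!%:R)^-1 *: X ^+ k)).

Section MatrixLogarithm.
Variables (R : realType) (n : nat).
Implicit Types (M X Z U H : 'M[R[i]]_n) (norm : 'M[R[i]]_n -> R).

(* In the order of R[i], [0 < z] says that z is real and positive. *)
Definition posdefmx H : Prop :=
  H \is hermsymmx /\
  forall v : 'cV[R[i]]_n, v != 0 -> 0 < (v^t* *m H *m v) 0 0.

Definition polar_decomposition Z U H : Prop :=
  [/\ U \is unitarymx, posdefmx H & Z = U *m H].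

(* The set of all the values of the multivalued logarithm Log M. *)
Definition logarithms M : set 'M[R[i]]_n := [set X | expm X = M].

Definition principal_logarithms M : set 'M[R[i]]_n :=
  [set X | logarithms M X /\
           forall l : R[i], eigenvalue X l -> - pi < complex.Im l < pi].

(* When M has no eigenvalue in ]-oo, 0], principal_logarithms M is a singleton,
   and logm M is its element; otherwise logm M is meaningless. *)
Definition logm M : 'M[R[i]]_n := xget 0 (principal_logarithms M).

Definition sym_part X : 'M[R[i]]_n := 2^-1 *: (X^t* + X).

(* The square roots of the eigenvalues of X^* X. *)
Definition singular_values X : set R :=
  [set s | 0 <= s /\ eigenvalue (X^t* *m X) (s ^+ 2)%:C].

(* There are finitely many singular values, and at least one if 0 < n, in which
   case the supremum is the largest one. For n = 0 it is 0. *)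
Definition spectral_norm X : R := sup (singular_values X).

Definition frobenius_norm X : R :=
  Num.sqrt (\sum_i \sum_j ComplexField.Normc.normc (X i j) ^+ 2).

(* The norms over which the two minima are taken: X ranges over all the
   logarithms of Q^* Z, for all the unitary Q. *)
Definition log_norms norm Z : set R :=
  [set r | exists Q X, [/\ Q \is unitarymx, logarithms (Q^t* *m Z) X
                         & r = norm X]].

Definition symlog_norms norm Z : set R :=
  [set r | exists Q X, [/\ Q \is unitarymx, logarithms (Q^t* *m Z) X
                         & r = norm (sym_part X)]].

Definition log_minimization norm Z U H : Prop :=
  [/\ is_minimum (log_norms norm Z) (norm (logm (U^t* *m Z))),
      is_minimum (symlog_norms norm Z) (norm (logm (U^t* *m Z)))
    & norm (logm (U^t* *m Z)) = norm (logm H)].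

End MatrixLogarithm.

(* Main.v *)
(* Let [exp X = Q^* Z = W H] with [W] unitary, so that [|exp(X) v| = |H v|].
   Writing [exp X] as the limit of [(1 + X / k) ^ k] and using
   [|(1 + h X) v|^2 = |v|^2 + 2 h Re <X v, v> + h^2 |X v|^2], any bounds
   [m |v|^2 <= Re <X v, v> <= M |v|^2] give [e^m |v| <= |H v| <= e^M |v|], hence
   [m <= ln h_i <= M] for the eigenvalues [h_i] of [H]. Since [Re <X v, v>] is the
   quadratic form of [sym X], this settles the spectral norm, and it places the
   [ln h_i] between the extreme eigenvalues of [sym X]. Moreover
   [|det (exp X)| = e^(Re tr X)] gives [sum ln h_i = tr (sym X)]. For at most three
   numbers these two facts are exactly majorization, so the sums of squares
   compare as required for the Frobenius norm; for larger [n] they would not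
   suffice. The minimum is attained at [Q = U], [X = log H].

   It remains to identify [log H], that is, to show that a logarithm of [H] with
   eigenvalues in the strip [|Im| < pi] acts as [ln h] on each eigenspace of [H]
   (see [principal_log_eigenspace]). *)
Require Import Defs.
From mathcomp Require Import all_boot all_order all_algebra.
From mathcomp Require Import spectral.
From mathcomp Require Import all_classical all_reals topology normedtype.
From mathcomp Require Import sequences exp trigo complex.
From mathcomp Require Import ring lra.

Set Implicit Arguments.
Unset Strict Implicit.
Unset Printing Implicit Defensive.

Import Order.TTheory GRing.Theory Num.Theory.
Import numFieldNormedType.Exports.

Local Open Scope classical_set_scope.
Local Open Scope ring_scope.
Local Open Scope sesquilinear_scope.
Local Open Scope complex_scope.

(** * Real Euler products and the exponential series *)

Section RealSequences.
Variable R : realType.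
Implicit Types (a b x : R).

Lemma cvg_mul_harmonic a : (fun k : nat => a * k.+1%:R^-1) @ \oo --> (0 : R).
Proof.
rewrite -[X in _ --> X](mulr0 a); apply: cvgMr; exact: cvg_harmonic.
Qed.

Lemma cvgn_comp_add2 (u : nat -> R) a :
  u @ \oo --> a -> (fun k => u k.+2) @ \oo --> a.
Proof. by rewrite -(cvg_shiftn 2); under eq_fun do rewrite /= addn2. Qed.

(** Invert [1 + y <= expR y] at [y = - x / (1 + x)], where [1 + y = 1 / (1 + x)]. *)
Lemma expR_le_onedivD x : 0 < 1 + x -> expR (x / (1 + x)) <= 1 + x.
Proof.
move=> x_gt; rewrite -[leRHS]invrK -[leLHS]invrK -expRN.
rewrite lef_pV2 ?posrE ?expR_gt0 ?invr_gt0 //.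
apply: le_trans (expR_ge1Dx _).
by rewrite le_eqVlt; apply/orP; left; apply/eqP; field; exact: lt0r_neq0.
Qed.

Lemma cvgn_expR_comp (u : nat -> R) a :
  u @ \oo --> a -> (fun k => expR (u k)) @ \oo --> expR a.
Proof. by move=> ua; exact: (cvg_comp _ _ ua (@continuous_expR R a)). Qed.

(** Squeeze: with [y k] the increment and [z k = (k + 1) * y k], which tends to [a], one has [expR
    (z / (1 + y)) <= (1 + y) ^ (k + 1) <= expR z] as soon as [1 + y > 0]. The term in [b] is meant
    for the [h^2 |X v|^2] of a matrix Euler step. *)
Lemma cvg_euler_real a b :
  (fun k : nat => (1 + a * k.+1%:R^-1 + b * k.+1%:R^-1 ^+ 2) ^+ k.+1) @ \oo
    --> expR a.
Proof.
pose y (k : nat) : R := a * k.+1%:R^-1 + b * k.+1%:R^-1 ^+ 2.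
pose z (k : nat) : R := a + b * k.+1%:R^-1.
have yE k : y k * k.+1%:R = z k by rewrite /y /z; field; rewrite addrC natr1 pnatr_eq0.
have y0 : y @ \oo --> (0 : R).
  rewrite -[X in _ --> X](addr0 0); apply: cvgD; first exact: cvg_mul_harmonic.
  rewrite -[X in _ --> X](mulr0 0).
  under eq_fun do rewrite expr2 mulrA.
  by apply: cvgM; [exact: cvg_mul_harmonic|exact: cvg_harmonic].
have za : z @ \oo --> a.
  rewrite -[X in _ --> X]addr0; apply: cvgD; first exact: cvg_cst.
  exact: cvg_mul_harmonic.
have y1 : (fun k => 1 + y k) @ \oo --> (1 : R).
  rewrite -[X in _ --> X](addr0 1); apply: cvgD => //; exact: cvg_cst.
have lo : (fun k => expR (z k / (1 + y k))) @ \oo --> expR a.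
  apply: cvgn_expR_comp.
  rewrite -[X in _ --> X]divr1; apply: cvgM => //.
  by apply: cvgV => //; rewrite oner_neq0.
have hi : (fun k => expR (z k)) @ \oo --> expR a.
  exact: cvgn_expR_comp.
apply: (squeeze_cvgr _ lo hi); near=> k.
have pos : 0 < 1 + y k.
  near: k; apply: (cvgr_gt (1 : R)) y1 _ _; exact: ltr01.
have -> : 1 + a * k.+1%:R^-1 + b * k.+1%:R^-1 ^+ 2 = 1 + y k by rewrite addrA.
rewrite -yE mulrAC !expRM_natr; apply/andP; split.
  by apply: lerXn2r; rewrite ?nnegrE ?expR_ge0 ?expR_le_onedivD // ltW.
by apply: lerXn2r; rewrite ?nnegrE ?expR_ge0 ?expR_ge1Dx // ltW.
Unshelve. all: by end_near. Qed.

Lemma cvg_exp_euler_real a :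
  (fun k : nat => (1 + a * k.+1%:R^-1) ^+ k.+1) @ \oo --> expR a.
Proof.
have := @cvg_euler_real a 0.
by under eq_fun do rewrite mul0r addr0.
Qed.

(** The coefficient of [x ^+ j] in [(1 + x / (k + 1)) ^ (k + 1)]; the shift to [k.+1] avoids a zero
    denominator. *)
Definition euler_coeff k j : R := 'C(k.+1, j)%:R * k.+1%:R^-1 ^+ j.

Lemma euler_coeff_le k j : euler_coeff k j <= (j`!%:R)^-1.
Proof.
rewrite /euler_coeff exprVn -[X in _ <= X]mul1r ler_pdivrMr ?exprn_gt0 ?ltr0n //.
rewrite mul1r mulrC ler_pdivlMr ?ltr0n ?fact_gt0 //.
rewrite -natrM -natrX ler_nat bin_ffact.
elim: j => [|j IH]; first by rewrite ffactn0 expn0.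
by rewrite ffactnSr expnSr leq_mul ?leq_subr.
Qed.

Lemma sum_euler_coeff k x :
  \sum_(j < k.+2) euler_coeff k j * x ^+ j = (1 + x * k.+1%:R^-1) ^+ k.+1.
Proof.
rewrite addrC exprD1n; apply: eq_bigr => j _.
by rewrite /euler_coeff exprMn mulrC mulrA mulr_natr mulrC mulrnAr mulrC.
Qed.

(* Since [euler_coeff k j <= 1 / j!], the difference of the [k]-th terms of the two
   sequences is dominated by its value for [c j = x ^+ j], which tends to
   [expR x - expR x = 0]. *)
Lemma cvg_series_euler (c : nat -> R) x : (forall j, `|c j| <= x ^+ j) ->
  exists l : R, series (fun j => c j / j`!%:R) @ \oo --> l /\
    (fun k => \sum_(j < k.+2) euler_coeff k j * c j) @ \oo --> l.
Proof.
move=> c_le; have x_ge0 : 0 <= x by have := c_le 1%N; apply: le_trans.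
set u := (X in series X).
have cvgu : cvgn (series u).
  apply: (@normed_cvg R R^o); apply: (@series_le_cvg _ _ (exp_coeff x)).
  - by move=> n /=.
  - by move=> n; apply: exp_coeff_ge0.
  - by move=> n /=; rewrite normrM normfV normr_nat ler_wpM2r ?invr_ge0.
  - exact: is_cvg_series_exp_coeff.
exists (limn (series u)); split; first exact: cvgu.
have cvgu2 : (fun k => series u k.+2) @ \oo --> limn (series u).
  exact: cvgn_comp_add2.
rewrite -[X in _ --> X]addr0.
have -> : (fun k => \sum_(j < k.+2) euler_coeff k j * c j) =
    (fun k => series u k.+2 + (\sum_(j < k.+2) euler_coeff k j * c j - series u k.+2)).
  by apply/funext => k; rewrite addrC subrK.
apply: cvgD => //.
have err0 : (fun k => series (exp_coeff x) k.+2 - (1 + x * k.+1%:R^-1) ^+ k.+1)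
    @ \oo --> (0 : R).
  rewrite -[X in _ --> X](subrr (expR x)); apply: cvgB; last exact: cvg_exp_euler_real.
  have := @is_cvg_series_exp_coeff R x.
  exact: cvgn_comp_add2.
apply: norm_cvg0; apply: (squeeze_cvgr _ (cvg_cst 0) err0); apply: nearW => k.
rewrite normr_ge0 /= !seriesEord -sumrB -sum_euler_coeff -sumrB.
apply: le_trans (ler_norm_sum _ _ _) _; apply: ler_sum => j _.
rewrite /u /exp_coeff /= [c j / _]mulrC -mulrBl normrM.
have le := euler_coeff_le k j.
rewrite [x ^+ j / _]mulrC -mulrBl distrC (@ger0_norm _ (_ - _)) ?subr_ge0 //.
by rewrite ler_wpM2l ?subr_ge0.
Qed.
End RealSequences.

(** * Componentwise convergence in [R[i]] and the complex exponential *)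

Section ComplexSequences.
Variable R : realType.
Local Notation C := R[i].
Local Notation Re := (@complex.Re R).
Local Notation Im := (@complex.Im R).
Local Notation normc := (@ComplexField.Normc.normc R).
Implicit Types (u v : nat -> C) (l m z w : C).

(* [R[i]] has no declared topology, hence the componentwise definition. *)
Definition cvgC u l :=
  (fun k => Re (u k)) @ \oo --> Re l /\ (fun k => Im (u k)) @ \oo --> Im l.

Lemma ReD z w : Re (z + w) = Re z + Re w. Proof. by case: z; case: w. Qed.
Lemma ImD z w : Im (z + w) = Im z + Im w. Proof. by case: z; case: w. Qed.
Lemma ReM z w : Re (z * w) = Re z * Re w - Im z * Im w.
Proof. by case: z; case: w. Qed.
Lemma ImM z w : Im (z * w) = Re z * Im w + Im z * Re w.
Proof. by case: z; case: w. Qed.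
Lemma ReN z : Re (- z) = - Re z. Proof. by case: z. Qed.
Lemma ImN z : Im (- z) = - Im z. Proof. by case: z. Qed.
Lemma Re_sum (I : finType) (F : I -> C) : Re (\sum_i F i) = \sum_i Re (F i).
Proof. exact: (big_morph Re ReD). Qed.
Lemma Im_sum (I : finType) (F : I -> C) : Im (\sum_i F i) = \sum_i Im (F i).
Proof. exact: (big_morph Im ImD). Qed.

Lemma cvgC_cst l : cvgC (fun=> l) l.
Proof. by split; exact: cvg_cst. Qed.

Lemma cvgCD u v l m : cvgC u l -> cvgC v m -> cvgC (fun k => u k + v k) (l + m).
Proof.
move=> [ur ui] [vr vi]; split; rewrite ?ReD ?ImD.
  by under eq_fun do rewrite ReD; exact: cvgD.
by under eq_fun do rewrite ImD; exact: cvgD.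
Qed.

Lemma cvgCN u l : cvgC u l -> cvgC (fun k => - u k) (- l).
Proof.
move=> [ur ui]; split; rewrite ?ReN ?ImN.
  by under eq_fun do rewrite ReN; exact: cvgN.
by under eq_fun do rewrite ImN; exact: cvgN.
Qed.

Lemma cvgCM u v l m : cvgC u l -> cvgC v m -> cvgC (fun k => u k * v k) (l * m).
Proof.
move=> [ur ui] [vr vi]; split; rewrite ?ReM ?ImM.
  by under eq_fun do rewrite ReM; apply: cvgB; exact: cvgM.
by under eq_fun do rewrite ImM; apply: cvgD; exact: cvgM.
Qed.

Lemma cvgC_sum (I : Type) (r : seq I) (u : I -> nat -> C) (l : I -> C) :
  (forall i, cvgC (u i) (l i)) ->
  cvgC (fun k => \sum_(i <- r) u i k) (\sum_(i <- r) l i).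
Proof.
move=> ul; elim: r => [|i r IH].
  by under eq_fun do rewrite big_nil; rewrite big_nil; exact: cvgC_cst.
by under eq_fun do rewrite big_cons; rewrite big_cons; exact: cvgCD.
Qed.

Lemma cvgC_prod (I : Type) (r : seq I) (u : I -> nat -> C) (l : I -> C) :
  (forall i, cvgC (u i) (l i)) ->
  cvgC (fun k => \prod_(i <- r) u i k) (\prod_(i <- r) l i).
Proof.
move=> ul; elim: r => [|i r IH].
  by under eq_fun do rewrite big_nil; rewrite big_nil; exact: cvgC_cst.
by under eq_fun do rewrite big_cons; rewrite big_cons; exact: cvgCM.
Qed.

Lemma cvgC_unique u l m : cvgC u l -> cvgC u m -> l = m.
Proof.
move=> [ur ui] [vr vi]; apply/eqP; rewrite eq_complex.
rewrite (cvg_unique _ ur vr) ?eqxx /=; last exact: norm_hausdorff.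
by rewrite (cvg_unique _ ui vi) ?eqxx //; exact: norm_hausdorff.
Qed.

Lemma normc_sqr z : normc z ^+ 2 = Re z ^+ 2 + Im z ^+ 2.
Proof. by case: z => a b; rewrite sqr_sqrtr // addr_ge0 ?sqr_ge0. Qed.

Lemma normc_ge0 z : 0 <= normc z.
Proof. by case: z => a b; exact: sqrtr_ge0. Qed.

Lemma abs_Re_le z : `|Re z| <= normc z.
Proof.
rewrite -(ler_pXn2r (ltn0Sn 1)) ?nnegrE ?normc_ge0 // normc_sqr real_normK ?num_real //.
by rewrite lerDl sqr_ge0.
Qed.

Lemma abs_Im_le z : `|Im z| <= normc z.
Proof.
rewrite -(ler_pXn2r (ltn0Sn 1)) ?nnegrE ?normc_ge0 // normc_sqr real_normK ?num_real //.
by rewrite lerDr sqr_ge0.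
Qed.

Lemma normc_le_ReIm z : normc z <= `|Re z| + `|Im z|.
Proof.
rewrite -(ler_pXn2r (ltn0Sn 1)) ?nnegrE ?normc_ge0 ?addr_ge0 // normc_sqr sqrrD.
rewrite !real_normK ?num_real // -addrA [X in _ <= _ + X]addrC addrA lerDl.
by rewrite mulrn_wge0 ?mulr_ge0.
Qed.

Lemma normcX z n : normc (z ^+ n) = normc z ^+ n.
Proof.
elim: n => [|n IH]; first by rewrite !expr0 ComplexField.Normc.normc1.
by rewrite !exprS ComplexField.Normc.normcM IH.
Qed.

Lemma normc_sum (I : finType) (F : I -> C) :
  normc (\sum_i F i) <= \sum_i normc (F i).
Proof.
elim/big_ind2 : _ => [|x a y b xa yb|//]; first by rewrite ComplexField.Normc.normc0.
by apply: le_trans (le_normcD _ _) _; exact: lerD.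
Qed.

Lemma normc_real (x : R) : normc x%:C = `|x|.
Proof. by rewrite /= expr0n /= addr0 sqrtr_sqr. Qed.

Lemma cvgC_near u l (e : R) : cvgC u l -> 0 < e ->
  \forall k \near \oo, normc (l - u k) < e.
Proof.
move=> [ur ui] e0; have e20 : 0 < e / 2 by rewrite divr_gt0.
near=> k; apply: le_lt_trans (normc_le_ReIm _) _; rewrite [e]splitr.
apply: ltrD; rewrite ?ReD ?ReN ?ImD ?ImN; near: k; exact: cvgr_dist_lt.
Unshelve. all: by end_near. Qed.

Lemma cvgC_squeeze u l (e : nat -> R) :
  (forall k, normc (u k - l) <= e k) -> e @ \oo --> (0 : R) -> cvgC u l.
Proof.
move=> ule e0; split; apply/subr_cvg0; apply: norm_cvg0;
  apply: (squeeze_cvgr _ (cvg_cst 0) e0); apply: nearW => k; rewrite normr_ge0 /=.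
  rewrite -ReN -ReD; exact: le_trans (abs_Re_le _) _.
rewrite -ImN -ImD; exact: le_trans (abs_Im_le _) _.
Qed.

Lemma cvgC_real (u : nat -> R) (a : R) :
  u @ \oo --> a -> cvgC (fun k => (u k)%:C) a%:C.
Proof. by move=> ua; split => //=; exact: cvg_cst. Qed.

Lemma cvgC_harmonic : cvgC (fun k => k.+1%:R^-1) 0.
Proof.
have -> : (fun k => k.+1%:R^-1 : C) = (fun k => (k.+1%:R^-1 : R)%:C).
  by apply/funext => k; rewrite fmorphV rmorph_nat.
exact/cvgC_real/cvg_harmonic.
Qed.

(** Real and imaginary parts inherit the bound on the modulus, so the real case applies to each. The
    common limit [l] serves to carry facts from exponential series over to Euler products. *)
Lemma cvgC_series_euler (c : nat -> C) (x : R) :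
  (forall j, normc (c j) <= x ^+ j) ->
  exists l, cvgC (series (fun j => (j`!%:R)^-1 * c j)) l /\
    cvgC (fun k => \sum_(j < k.+2) (euler_coeff R k j)%:C * c j) l.
Proof.
move=> c_le.
have [a [a1 a2]] := @cvg_series_euler R (Re \o c) x
  (fun j => le_trans (abs_Re_le _) (c_le j)).
have [b [b1 b2]] := @cvg_series_euler R (Im \o c) x
  (fun j => le_trans (abs_Im_le _) (c_le j)).
have ReZ (t : R) w : Re (t%:C * w) = t * Re w by case: w => p q /=; rewrite mul0r subr0.
have ImZ (t : R) w : Im (t%:C * w) = t * Im w by case: w => p q /=; rewrite mul0r addr0.
have factE j : (j`!%:R)^-1 = ((j`!%:R)^-1 : R)%:C :> C by rewrite fmorphV rmorph_nat.
exists (a +i* b); split; split => /=.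
- suff -> : (fun k => Re (series (fun j => (j`!%:R)^-1 * c j) k)) =
    series (fun j => (Re \o c) j / j`!%:R) by [].
  apply/funext => k; rewrite !seriesEord /= Re_sum; apply: eq_bigr => j _.
  by rewrite factE ReZ mulrC.
- suff -> : (fun k => Im (series (fun j => (j`!%:R)^-1 * c j) k)) =
    series (fun j => (Im \o c) j / j`!%:R) by [].
  apply/funext => k; rewrite !seriesEord /= Im_sum; apply: eq_bigr => j _.
  by rewrite factE ImZ mulrC.
- by under eq_fun do (rewrite Re_sum; under eq_bigr do rewrite ReZ).
- by under eq_fun do (rewrite Im_sum; under eq_bigr do rewrite ImZ).
Qed.

Lemma euler_coeffC k j :
  (euler_coeff R k j)%:C = 'C(k.+1, j)%:R * k.+1%:R^-1 ^+ j :> C.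
Proof. by rewrite rmorphM rmorph_nat rmorphXn fmorphV rmorph_nat. Qed.

Lemma sum_euler_coeffC k z :
  \sum_(j < k.+2) (euler_coeff R k j)%:C * z ^+ j = (1 + k.+1%:R^-1 * z) ^+ k.+1.
Proof.
rewrite addrC exprD1n; apply: eq_bigr => j _.
by rewrite euler_coeffC exprMn -mulrA mulr_natl.
Qed.

(** The limit is read off the series: by the parity of [j], the term [(i y)^j / j!] is a coefficient
    of [cos] or [i] times one of [sin]. The Euler products have the same limit as the series. *)
Lemma cvgC_exp_imaginary (y : R) :
  cvgC (fun k => (1 + k.+1%:R^-1 * (0 +i* y)) ^+ k.+1) (cos y +i* sin y).
Proof.
have bound j : normc ((0 +i* y) ^+ j) <= `|y| ^+ j.
  by rewrite normcX /= expr0n add0r sqrtr_sqr.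
have [l [ser eul]] := cvgC_series_euler bound.
suff <- : l = cos y +i* sin y.
  by move: eul; under eq_fun do rewrite sum_euler_coeffC.
apply: (cvgC_unique ser).
have powE j : (j`!%:R)^-1 * (0 +i* y) ^+ j = cos_coeff y j +i* sin_coeff y j :> C.
  have -> : (0 +i* y) = 'i * y%:C :> C by simpc.
  rewrite exprMn -rmorphXn /=.
  have -> : (j`!%:R)^-1 = ((j`!%:R)^-1 : R)%:C :> C by rewrite fmorphV rmorph_nat.
  have iE : 'i ^+ j = (-1) ^+ j./2 * 'i ^+ odd j :> C.
    by rewrite -{1}(odd_double_half j) exprD -mul2n exprM sqr_i mulrC.
  have sgE (m : nat) : (-1) ^+ m = ((-1) ^+ m : R)%:C :> C by rewrite rmorphXn rmorphN1.
  rewrite iE sgE /cos_coeff /sin_coeff /=.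
  have [jodd|jeven] := boolP (odd j).
    rewrite expr1; simpc; congr (_ +i* _).
    have -> : j.-1./2 = j./2 by rewrite -{1}(odd_double_half j) jodd /= doubleK.
    by rewrite mulrC.
  by rewrite expr0; simpc; congr (_ +i* _); rewrite mulrC.
split => /=.
  suff -> : (fun k => Re (series (fun j => (j`!%:R)^-1 * (0 +i* y) ^+ j) k)) =
      series (cos_coeff y).
    by rewrite unlock; exact: is_cvg_series_cos_coeff.
  apply/funext => k; rewrite !seriesEord /= Re_sum.
  by apply: eq_bigr => j _; rewrite powE.
suff -> : (fun k => Im (series (fun j => (j`!%:R)^-1 * (0 +i* y) ^+ j) k)) =
    series (sin_coeff y).
  by rewrite unlock; exact: is_cvg_series_sin_coeff.
apply/funext => k; rewrite !seriesEord /= Im_sum.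
by apply: eq_bigr => j _; rewrite powE.
Qed.

(** Factor out [z - w]: the cofactor is a sum of [n] products of total degree [n - 1], each of
    modulus at most [r ^+ n.-1]. *)
Lemma normc_subX_le z w (r : R) n : normc z <= r -> normc w <= r ->
  normc (z ^+ n - w ^+ n) <= normc (z - w) * (n%:R * r ^+ n.-1).
Proof.
move=> zr wr; have r0 := le_trans (normc_ge0 _) zr.
rewrite subrXX ComplexField.Normc.normcM ler_wpM2l ?normc_ge0 //.
apply: le_trans (normc_sum _) _; rewrite mulr_natl -[n in _ *+ n]card_ord -sumr_const.
apply: ler_sum => i _; rewrite ComplexField.Normc.normcM !normcX.
have -> : r ^+ n.-1 = r ^+ (n.-1 - i) * r ^+ i.
  by rewrite -exprD subnK //; case: n i => [[]//|n i] /=; rewrite -ltnS.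
by apply: ler_pM; rewrite ?exprn_ge0 ?normc_ge0 ?lerXn2r ?nnegrE ?normc_ge0.
Qed.

(** With [h = 1 / (k + 1)], the product [(1 + h x) (1 + i h y)] differs from [1 + h (x + i y)] by
    [i h^2 x y] only, so the [(k + 1)]-th powers differ by [O(h)]; the powers of the product
    converge by the real and imaginary cases. *)
Lemma cvgC_exp z :
  cvgC (fun k => (1 + k.+1%:R^-1 * z) ^+ k.+1)
    ((expR (Re z))%:C * (cos (Im z) +i* sin (Im z))).
Proof.
case: z => x y /=.
pose p k : C := (1 + k.+1%:R^-1 * x%:C) * (1 + k.+1%:R^-1 * (0 +i* y)).
pose q k : C := 1 + k.+1%:R^-1 * (x +i* y).
have pexp : cvgC (fun k => p k ^+ k.+1) ((expR x)%:C * (cos y +i* sin y)).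
  under eq_fun do rewrite exprMn; apply: cvgCM; last exact: cvgC_exp_imaginary.
  have -> : (fun k => (1 + k.+1%:R^-1 * x%:C) ^+ k.+1 : C) =
      (fun k => ((1 + x * k.+1%:R^-1) ^+ k.+1)%:C).
    by apply/funext => k; rewrite rmorphXn rmorphD rmorphM fmorphV rmorph_nat mulrC.
  exact/cvgC_real/cvg_exp_euler_real.
(* [M] makes [1 + h M] dominate both [p k] and [q k] in modulus, since [h <= 1]. *)
pose M : R := `|x| + `|y| + `|x| * `|y|.
suff diff0 : cvgC (fun k => q k ^+ k.+1 - p k ^+ k.+1) 0.
  have := cvgCD diff0 pexp; rewrite add0r.
  by under eq_fun do rewrite subrK.
apply: (@cvgC_squeeze _ _ (fun k => (`|x| * `|y| * expR M) * k.+1%:R^-1)); last first.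
  exact: cvg_mul_harmonic.
move=> k; rewrite subr0; set h : R := k.+1%:R^-1.
have hC : k.+1%:R^-1 = h%:C by rewrite /h fmorphV rmorph_nat.
have h0 : 0 <= h by rewrite invr_ge0.
have h1 : h <= 1 by rewrite invf_le1 ?ltr0n // ler1n.
have n1 : normc 1 = 1 by exact: ComplexField.Normc.normc1.
have xle : normc (1 + h%:C * x%:C) <= 1 + h * `|x|.
  apply: le_trans (le_normcD _ _) _.
  by rewrite n1 -rmorphM normc_real normrM (ger0_norm h0).
have yle : normc (1 + h%:C * (0 +i* y)) <= 1 + h * `|y|.
  apply: le_trans (le_normcD _ _) _.
  rewrite n1 ComplexField.Normc.normcM normc_real (ger0_norm h0).
  by rewrite /= expr0n add0r sqrtr_sqr.
have ple : normc (p k) <= 1 + h * M.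
  rewrite /p hC ComplexField.Normc.normcM.
  apply: le_trans (ler_pM (normc_ge0 _) (normc_ge0 _) xle yle) _.
  rewrite -subr_ge0 /M.
  have -> : 1 + h * (`|x| + `|y| + `|x| * `|y|) - (1 + h * `|x|) * (1 + h * `|y|) =
    h * (1 - h) * (`|x| * `|y|) by ring.
  by rewrite !mulr_ge0 ?subr_ge0.
have qle : normc (q k) <= 1 + h * M.
  apply: le_trans (le_normcD _ _) _; rewrite n1 lerD2l hC ComplexField.Normc.normcM.
  rewrite normc_real (ger0_norm h0) ler_wpM2l //.
  apply: le_trans (normc_le_ReIm _) _; rewrite /= /M lerDl; exact: mulr_ge0.
apply: le_trans (normc_subX_le _ qle ple) _.
have -> : q k - p k = - (h ^+ 2 * x * y)%:C * 'i.
  by rewrite /q /p hC expr2; simpc; congr (_ +i* _); ring.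
rewrite ComplexField.Normc.normcM normcN normc_real.
have -> : normc 'i = 1 by rewrite /= expr0n expr1n add0r sqrtr1.
rewrite !normrM !(ger0_norm h0) mulr1 /=.
(* The factor [k + 1] from the difference of powers uses up one [h] of [h^2]; the other one tends to
   zero. *)
have hn : h * k.+1%:R = 1 by rewrite /h mulVf ?pnatr_eq0.
have -> : h * h * `|x| * `|y| * (k.+1%:R * (1 + h * M) ^+ k) =
    `|x| * `|y| * (1 + h * M) ^+ k * h * (h * k.+1%:R) by ring.
rewrite hn mulr1 ler_wpM2r // ler_wpM2l ?mulr_ge0 //.
(* Uniform bound: [(1 + h M) ^ k <= (1 + h M) ^ (k + 1) <= expR (h M) ^ (k + 1) = expR M]. *)
have M0 : 0 <= h * M by rewrite mulr_ge0 // !addr_ge0 ?mulr_ge0.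
apply: (@le_trans _ _ ((1 + h * M) ^+ k.+1)).
  by rewrite exprS ler_peMl ?exprn_ge0 ?lerDl ?addr_ge0.
apply: (@le_trans _ _ (expR (h * M) ^+ k.+1)).
  by rewrite lerXn2r ?nnegrE ?expR_ge0 ?addr_ge0 ?expR_ge1Dx.
by rewrite -expRM_natr mulrAC hn mul1r.
Qed.

End ComplexSequences.

(** * The matrix exponential as a limit of Euler products *)

(** Proved over an abstract field, where the topology behind [expm] is visible. The epsilon form of
    the hypothesis makes it applicable to [R[i]], whose convergence is handled by components. *)
Lemma expm_cvg (C : numFieldType) (n : nat) (X L : 'M[C]_n) :
  (forall e : C, 0 < e -> \forall k \near \oo, forall i j,
     `|L i j - series (fun k : nat => (k`!%:R)^-1 *: X ^+ k) k i j| < e) ->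
  expm X = L.
Proof.
move=> cvgL; rewrite /expm; apply/cvg_lim; first exact: norm_hausdorff.
apply/cvg_ballP => e e0.
by have := cvgL e e0; apply: filterS => k kP; split.
Qed.

Section MatrixSequences.
Variable R : realType.
Local Notation C := R[i].
Local Notation Re := (@complex.Re R).
Local Notation normc := (@ComplexField.Normc.normc R).

Definition cvgmx m n (A : nat -> 'M[C]_(m, n)) (L : 'M[C]_(m, n)) :=
  forall i j, cvgC (fun k => A k i j) (L i j).

Lemma cvgmx_unique m n (A : nat -> 'M[C]_(m, n)) L M :
  cvgmx A L -> cvgmx A M -> L = M.
Proof. by move=> AL AM; apply/matrixP => i j; apply: cvgC_unique (AL i j) (AM i j). Qed.

Lemma cvgmx_cst m n (L : 'M[C]_(m, n)) : cvgmx (fun=> L) L.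
Proof. by move=> i j; exact: cvgC_cst. Qed.

Lemma cvgmx_mul m n p (A : nat -> 'M[C]_(m, n)) (B : nat -> 'M[C]_(n, p)) L M :
  cvgmx A L -> cvgmx B M -> cvgmx (fun k => A k *m B k) (L *m M).
Proof.
move=> AL BM i j; rewrite mxE; under eq_fun do rewrite mxE.
by apply: cvgC_sum => l; exact: cvgCM.
Qed.

Lemma cvgC_det n (A : nat -> 'M[C]_n) L :
  cvgmx A L -> cvgC (fun k => \det (A k)) (\det L).
Proof.
move=> AL; apply: cvgC_sum => s; apply: cvgCM; first exact: cvgC_cst.
by apply: cvgC_prod => i.
Qed.

(** The sum of the moduli of all entries dominates each row sum, which lets the induction pass
    through a product. This is the geometric bound required by [cvgC_series_euler]. *)
Lemma entry_exp_bound n (X : 'M[C]_n) j a b :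
  normc ((X ^+ j) a b) <= (\sum_a \sum_b normc (X a b)) ^+ j.
Proof.
set x := \sum_a _.
have x0 : 0 <= x by do 2 (apply: sumr_ge0 => ? _); exact: normc_ge0.
elim: j a b => [|j IH] a b.
  rewrite !expr0 mxE; case: (a == b) => /=; rewrite expr0n /= addr0.
    by rewrite expr1n sqrtr1.
  by rewrite sqrtr0.
rewrite !exprS mxE; apply: le_trans (normc_sum _) _.
apply: (@le_trans _ _ (\sum_c normc (X a c) * x ^+ j)).
  apply: ler_sum => c _; rewrite ComplexField.Normc.normcM.
  by rewrite ler_wpM2l ?normc_ge0.
rewrite -mulr_suml ler_wpM2r ?exprn_ge0 // /x [leRHS](bigD1 a) //= lerDl.
by do 2 (apply: sumr_ge0 => ? _); exact: normc_ge0.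
Qed.

Definition eulermx n (X : 'M[C]_n) (k : nat) : 'M[C]_n :=
  (1 + k.+1%:R^-1 *: X) ^+ k.+1.

Lemma exprZmx n (a : C) (X : 'M[C]_n) j : (a *: X) ^+ j = a ^+ j *: X ^+ j.
Proof.
elim: j => [|j IH]; first by rewrite !expr0 scale1r.
by rewrite !exprS IH -mulmxE -scalemxAl -scalemxAr scalerA.
Qed.

Lemma eulermx_sum n (X : 'M[C]_n) k :
  eulermx X k = \sum_(j < k.+2) (euler_coeff R k j)%:C *: X ^+ j.
Proof.
rewrite /eulermx addrC exprD1n; apply: eq_bigr => j _.
by rewrite exprZmx euler_coeffC -scalerA scaler_nat.
Qed.

(** Entry by entry, the series and the Euler products have a common limit; the series identifies it
    with [expm X]. *)
Lemma cvgmx_expm n (X : 'M[C]_n) : cvgmx (eulermx X) (expm X).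
Proof.
pose P a b l := cvgC (series (fun j => (j`!%:R)^-1 * (X ^+ j) a b)) l /\
  cvgC (fun k => \sum_(j < k.+2) (euler_coeff R k j)%:C * (X ^+ j) a b) l.
(* [xget] assembles the limits of the entries into a matrix; [LP] shows that its default value is
   never taken. *)
pose L := \matrix_(a, b) xget 0 [set l | P a b l].
have LP a b : P a b (L a b).
  rewrite mxE; apply: (@xgetPex _ 0 [set l | P a b l]).
  exact: cvgC_series_euler (fun j => entry_exp_bound X j a b).
suff -> : expm X = L.
  move=> a b; under eq_fun do rewrite eulermx_sum summxE.
  by under eq_fun do (under eq_bigr do rewrite mxE); case: (LP a b).
(* In the order of [R[i]], [0 < e] forces [e] to be real. *)
apply: expm_cvg => e; rewrite ltcE /= => /andP[/eqP Ime0 Ree].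
have -> : e = (Re e)%:C by case: e Ime0 {Ree} => ? ? /= ->.
apply: filter_forall => a; apply: filter_forall => b.
have [/cvgC_near/(_ Ree) near_ab _] := LP a b.
apply: filterS near_ab => k; rewrite normc_def ltcR.
suff -> : series (fun k : nat => (k`!%:R)^-1 *: X ^+ k) k a b =
    series (fun j => (j`!%:R)^-1 * (X ^+ j) a b) k by case: (_ - _).
by rewrite !seriesEord /= summxE; apply: eq_bigr => j _; rewrite mxE.
Qed.

End MatrixSequences.

(** * The real inner product and growth bounds for [exp X] *)

Section RealInnerProduct.
Variable R : realType.
Local Notation C := R[i].
Local Notation Re := (@complex.Re R).
Local Notation Im := (@complex.Im R).
Local Notation normc := (@ComplexField.Normc.normc R).

(** The real part of the Hermitian product [u^* v], that is, the Euclidean product of the underlying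
    real space; its values lie in the ordered field [R], where inequalities are easy to handle. *)
Definition rdot n (u v : 'cV[C]_n) : R :=
  \sum_i (Re (u i 0) * Re (v i 0) + Im (u i 0) * Im (v i 0)).
Definition sqn n (v : 'cV[C]_n) : R := rdot v v.

Lemma rdotC n (u v : 'cV[C]_n) : rdot u v = rdot v u.
Proof. by apply: eq_bigr => i _; rewrite mulrC [X in _ + X]mulrC. Qed.

Lemma rdotDl n (u v w : 'cV[C]_n) : rdot (u + v) w = rdot u w + rdot v w.
Proof.
rewrite -big_split; apply: eq_bigr => i _ /=; rewrite mxE ReD ImD; ring.
Qed.

Lemma rdotDr n (u v w : 'cV[C]_n) : rdot u (v + w) = rdot u v + rdot u w.
Proof. by rewrite rdotC rdotDl !(rdotC u). Qed.

Lemma rdotZl n (a : R) (u v : 'cV[C]_n) : rdot (a%:C *: u) v = a * rdot u v.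
Proof.
rewrite mulr_sumr; apply: eq_bigr => i _ /=; rewrite mxE ReM ImM /=; ring.
Qed.

Lemma rdotZr n (a : R) (u v : 'cV[C]_n) : rdot u (a%:C *: v) = a * rdot u v.
Proof. by rewrite rdotC rdotZl rdotC. Qed.

Lemma sqnE n (v : 'cV[C]_n) : sqn v = \sum_i normc (v i 0) ^+ 2.
Proof. by apply: eq_bigr => i _; rewrite normc_sqr !expr2. Qed.

Lemma sqn_ge0 n (v : 'cV[C]_n) : 0 <= sqn v.
Proof. by rewrite sqnE; apply: sumr_ge0 => i _; exact: sqr_ge0. Qed.

Lemma sqn_gt0 n (v : 'cV[C]_n) : v != 0 -> 0 < sqn v.
Proof.
move=> v0; rewrite lt_neqAle sqn_ge0 andbT eq_sym; apply: contraNneq v0 => /eqP.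
rewrite sqnE psumr_eq0 => [/allP v0|i _]; last exact: sqr_ge0.
apply/eqP/colP => i; rewrite mxE; apply: ComplexField.Normc.eq0_normc; apply/eqP.
by have := v0 i (mem_index_enum _); rewrite sqrf_eq0.
Qed.

Lemma rdot_trmxC n (u v : 'cV[C]_n) : rdot u v = Re ((u^t* *m v) 0 0).
Proof.
rewrite mxE Re_sum; apply: eq_bigr => i _; rewrite !mxE ReM.
by case: (u i 0) => a b /=; rewrite mulNr opprK.
Qed.

Lemma trmxC_mul m n p (A : 'M[C]_(m, n)) (B : 'M[C]_(n, p)) :
  (A *m B)^t* = B^t* *m A^t*.
Proof. by rewrite trmx_mul map_mxM. Qed.

Lemma rdot_adjoint m n (A : 'M[C]_(m, n)) (u : 'cV[C]_n) (v : 'cV[C]_m) :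
  rdot (A *m u) v = rdot u (A^t* *m v).
Proof. by rewrite !rdot_trmxC trmxC_mul mulmxA. Qed.

Lemma unitary_trmxC_mul n (P : 'M[C]_n) : P \is unitarymx -> P^t* *m P = 1%:M.
Proof. by move=> Pu; apply: mulmx1C; apply/unitarymxP. Qed.

Lemma sqn_unitary n (P : 'M[C]_n) (v : 'cV[C]_n) :
  P \is unitarymx -> sqn (P *m v) = sqn v.
Proof.
by move=> Pu; rewrite /sqn rdot_adjoint mulmxA unitary_trmxC_mul // mul1mx.
Qed.

(** [X] and [X^*] have the same real quadratic form, by adjunction and symmetry of [rdot]. *)
Lemma rdot_sym_part n (X : 'M[C]_n) (v : 'cV[C]_n) :
  rdot v (sym_part X *m v) = rdot v (X *m v).
Proof.
have half : (2^-1 : C) = (2^-1 : R)%:C by rewrite fmorphV rmorph_nat.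
rewrite /sym_part -scalemxAl half rdotZr mulmxDl rdotDr.
rewrite -rdot_adjoint [rdot (X *m v) v]rdotC.
by field.
Qed.

Lemma sqn_euler_step n (X : 'M[C]_n) (h : R) (v : 'cV[C]_n) :
  sqn ((1%:M + h%:C *: X) *m v) =
  sqn v + 2 * h * rdot v (X *m v) + h ^+ 2 * sqn (X *m v).
Proof.
rewrite mulmxDl mul1mx -scalemxAl /sqn !rdotDl !rdotDr !rdotZl !rdotZr.
by rewrite (rdotC (X *m v) v); ring.
Qed.

Lemma cvg_sqn n (A : nat -> 'cV[C]_n) L :
  cvgmx A L -> (fun k => sqn (A k)) @ \oo --> sqn L.
Proof.
move=> AL.
have cvg_sum (I : Type) (r : seq I) (f : I -> nat -> R) (l : I -> R) :
    (forall i, f i @ \oo --> l i) ->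
    (fun k => \sum_(i <- r) f i k) @ \oo --> \sum_(i <- r) l i.
  move=> fl; elim: r => [|i r IH].
    by under eq_fun do rewrite big_nil; rewrite big_nil; exact: cvg_cst.
  by under eq_fun do rewrite big_cons; rewrite big_cons; exact: cvgD.
apply: cvg_sum => i; have [Lr Li] := AL i 0.
by apply: cvgD; exact: cvgM.
Qed.

Lemma sqn_exprmx_le n (A : 'M[C]_n) (r : R) : 0 <= r ->
  (forall v : 'cV[C]_n, sqn (A *m v) <= r * sqn v) ->
  forall k (v : 'cV[C]_n), sqn (A ^+ k *m v) <= r ^+ k * sqn v.
Proof.
move=> r0 Ar; elim=> [|k IH] v; first by rewrite !expr0 mul1mx mul1r.
rewrite !exprS -mulmxE -mulmxA; apply: le_trans (Ar _) _.
by rewrite -mulrA ler_wpM2l.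
Qed.

Lemma sqn_exprmx_ge n (A : 'M[C]_n) (r : R) : 0 <= r ->
  (forall v : 'cV[C]_n, r * sqn v <= sqn (A *m v)) ->
  forall k (v : 'cV[C]_n), r ^+ k * sqn v <= sqn (A ^+ k *m v).
Proof.
move=> r0 Ar; elim=> [|k IH] v; first by rewrite !expr0 mul1mx mul1r.
rewrite !exprS -mulmxE -mulmxA; apply: le_trans (Ar _).
by rewrite -mulrA ler_wpM2l.
Qed.

Lemma eulermxE n (X : 'M[C]_n) k :
  eulermx X k = (1%:M + (k.+1%:R^-1 : R)%:C *: X) ^+ k.+1.
Proof. by rewrite /eulermx fmorphV rmorph_nat. Qed.

Lemma cvg_sqn_eulermx n (X : 'M[C]_n) (v : 'cV[C]_n) :
  (fun k => sqn (eulermx X k *m v)) @ \oo --> sqn (expm X *m v).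
Proof. by apply/cvg_sqn/cvgmx_mul; [exact: cvgmx_expm|exact: cvgmx_cst]. Qed.

(** One Euler step of size [h] multiplies [sqn] by at most [1 + 2 c h + b h^2]. Iterate, and let the
    step size tend to zero: [b] disappears from the limit. *)
Lemma sqn_expm_le n (X : 'M[C]_n) (b c : R) (v : 'cV[C]_n) : 0 <= b ->
  (forall u : 'cV[C]_n, sqn (X *m u) <= b * sqn u) ->
  (forall u : 'cV[C]_n, rdot u (X *m u) <= c * sqn u) ->
  sqn (expm X *m v) <= expR (2 * c) * sqn v.
Proof.
move=> b0 Xb Xc; have lim : (fun k : nat =>
    (1 + 2 * c * k.+1%:R^-1 + b * k.+1%:R^-1 ^+ 2) ^+ k.+1 * sqn v) @ \oo -->
    expR (2 * c) * sqn v.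
  by apply: cvgM; [exact: cvg_euler_real|exact: cvg_cst].
apply: (ler_cvg_to (@cvg_sqn_eulermx n X v) lim); near=> k.
rewrite eulermxE; apply: sqn_exprmx_le => [|u].
  (* Since [c] may be negative, the factor is nonnegative only for large [k]. *)
  near: k.
  have : (fun k : nat => 1 + 2 * c * k.+1%:R^-1) @ \oo --> (1 : R).
    rewrite -[X in _ --> X]addr0; apply: cvgD; first exact: cvg_cst.
    exact: cvg_mul_harmonic.
  move=> /cvgr_gt/(_ 0 ltr01); apply: filterS => k kpos.
  by rewrite addr_ge0 ?mulr_ge0 ?exprn_ge0 ?invr_ge0 // ltW.
set h : R := k.+1%:R^-1; have h0 : 0 <= h by rewrite invr_ge0.
rewrite sqn_euler_step.
have -> : (1 + 2 * c * h + b * h ^+ 2) * sqn u =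
  sqn u + 2 * h * (c * sqn u) + h ^+ 2 * (b * sqn u) by ring.
by rewrite !lerD ?ler_wpM2l ?mulr_ge0 ?exprn_ge0.
Unshelve. all: by end_near. Qed.

(** As for the upper bound, except that [h^2 |X u|^2 >= 0] is simply dropped, so no bound on [X]
    enters. *)
Lemma sqn_expm_ge n (X : 'M[C]_n) (c : R) (v : 'cV[C]_n) :
  (forall u : 'cV[C]_n, c * sqn u <= rdot u (X *m u)) ->
  expR (2 * c) * sqn v <= sqn (expm X *m v).
Proof.
move=> Xc.
have lim : (fun k : nat => (1 + 2 * c * k.+1%:R^-1) ^+ k.+1 * sqn v) @ \oo -->
    expR (2 * c) * sqn v.
  by apply: cvgM; [exact: cvg_exp_euler_real|exact: cvg_cst].
apply: (ler_cvg_to lim (@cvg_sqn_eulermx n X v)); near=> k.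
rewrite eulermxE; apply: sqn_exprmx_ge => [|u].
  near: k.
  have : (fun k : nat => 1 + 2 * c * k.+1%:R^-1) @ \oo --> (1 : R).
    rewrite -[X in _ --> X]addr0; apply: cvgD; first exact: cvg_cst.
    exact: cvg_mul_harmonic.
  by move=> /cvgr_gt/(_ 0 ltr01); apply: filterS => k /ltW.
set h : R := k.+1%:R^-1; have h0 : 0 <= h by rewrite invr_ge0.
rewrite sqn_euler_step; apply: ler_wpDr; first by rewrite mulr_ge0 ?exprn_ge0 ?sqn_ge0.
have -> : (1 + 2 * c * h) * sqn u = sqn u + 2 * h * (c * sqn u) by ring.
by rewrite lerD2l ler_wpM2l ?mulr_ge0.
Unshelve. all: by end_near. Qed.

End RealInnerProduct.

(** * Unitary diagonalization and functional calculus *)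

Lemma hermitian_spectralE (C : numClosedFieldType) n (A : 'M[C]_n) :
  A \is hermsymmx ->
  A = (spectralmx A)^t* *m diag_mx (spectral_diag A) *m spectralmx A.
Proof.
move=> /hermitian_normalmx/orthomx_spectralP AE.
by rewrite -invmx_unitary // spectral_unitarymx.
Qed.

Section UnitaryDiagonalization.
Variable R : realType.
Local Notation C := R[i].
Local Notation Re := (@complex.Re R).
Local Notation normc := (@ComplexField.Normc.normc R).

(** The eigenvalues form a function into [R], so that functional calculus is composition: the
    exponential of [d] is [expR] applied to each [d i]. The eigenvectors are the columns of
    [P^*]. *)
Definition udiag n (P : 'M[C]_n) (d : 'I_n -> R) : 'M[C]_n :=
  P^t* *m diag_mx (\row_i (d i)%:C) *m P.

Lemma hermitian_udiag n (A : 'M[C]_n) : A^t* = A ->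
  exists P d, P \is unitarymx /\ A = udiag P d.
Proof.
move=> Aherm.
have Ah : A \is hermsymmx by apply/is_hermitianmxP; rewrite expr0 scale1r.
exists (spectralmx A), (fun i => Re (spectral_diag A 0 i)).
split; first exact: spectral_unitarymx.
have dE : \row_i (Re (spectral_diag A 0 i))%:C = spectral_diag A.
  apply/rowP => i; rewrite mxE RRe_real //.
  exact/mxOverP/hermitian_spectral_diag_real.
by rewrite /udiag dE -(hermitian_spectralE Ah).
Qed.

Section Fixed.
Variables (n : nat) (P : 'M[C]_n).
Hypothesis P_unitary : P \is unitarymx.
Implicit Types d e : 'I_n -> R.

Lemma unitary_mul_trmxC : P *m P^t* = 1%:M.
Proof. exact/unitarymxP. Qed.

Lemma diag_realmx_mul m d (A : 'M[C]_(n, m)) i j :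
  (diag_mx (\row_i (d i)%:C) *m A) i j = (d i)%:C * A i j.
Proof. by rewrite mul_diag_mx !mxE. Qed.

Lemma udiag_hermitian d : (udiag P d)^t* = udiag P d.
Proof.
rewrite /udiag !trmxC_mul trmxCK mulmxA.
suff -> : (diag_mx (\row_i (d i)%:C))^t* = diag_mx (\row_i (d i)%:C) by [].
apply/matrixP => i j; rewrite !mxE eq_sym.
by case: eqP => [->|_]; rewrite ?mulr1n ?mulr0n; exact: conjc_real.
Qed.

Lemma udiag_mul d e : udiag P d *m udiag P e = udiag P (fun i => d i * e i).
Proof.
rewrite /udiag -!mulmxA (mulmxA P) unitary_mul_trmxC mul1mx.
rewrite (mulmxA (diag_mx _)) mulmx_diag; congr (_ *m (diag_mx _ *m _)).
by apply/rowP => i; rewrite !mxE rmorphM.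
Qed.

Lemma rdot_udiag d (v : 'cV[C]_n) :
  rdot v (udiag P d *m v) = \sum_i d i * normc ((P *m v) i 0) ^+ 2.
Proof.
rewrite /udiag -!mulmxA -{1}(trmxCK P) -rdot_adjoint trmxCK.
apply: eq_bigr => i _; rewrite diag_realmx_mul ReM ImM normc_sqr /=; ring.
Qed.

Lemma sqn_udiag d (v : 'cV[C]_n) :
  sqn (udiag P d *m v) = \sum_i d i ^+ 2 * normc ((P *m v) i 0) ^+ 2.
Proof.
by rewrite /sqn rdot_adjoint udiag_hermitian mulmxA udiag_mul rdot_udiag.
Qed.

Definition eigencol i : 'cV[C]_n := P^t* *m delta_mx i 0.

Lemma sqn_eigencol i : sqn (eigencol i) = 1.
Proof.
rewrite /sqn rdot_adjoint trmxCK mulmxA unitary_mul_trmxC mul1mx -/(sqn _) sqnE.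
rewrite (bigD1 i) //= big1 => [|j ji]; rewrite mxE eqxx andbT.
  by rewrite mulr1n ComplexField.Normc.normc1 expr1n addr0.
by rewrite (negbTE ji) mulr0n ComplexField.Normc.normc0 expr0n.
Qed.

Lemma udiag_eigencol d i : udiag P d *m eigencol i = (d i)%:C *: eigencol i.
Proof.
rewrite /udiag /eigencol -!mulmxA (mulmxA P) unitary_mul_trmxC mul1mx.
rewrite scalemxAr; congr (_ *m _); apply/colP => j; rewrite diag_realmx_mul !mxE.
by case: eqP => [->//|_]; rewrite !mulr0.
Qed.

(** [eigenvalue] concerns row vectors. In the coordinates [v P^*], any nonzero coordinate [i] forces
    [a = d i]; conversely, row [i] of [P] is an eigenvector. *)
Lemma eigenvalue_udiagP d (a : C) :
  reflect (exists i, a = (d i)%:C) (eigenvalue (udiag P d) a).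
Proof.
apply: (iffP eigenvalueP) => [[v vE v0]|[i ->]].
  have w0 : v *m P^t* != 0.
    apply: contraNneq v0 => w0.
    by rewrite -(mulmx1 v) -(unitary_trmxC_mul P_unitary) mulmxA w0 mul0mx.
  have /rV0Pn[i wi] := w0; exists i.
  have := congr1 (fun u : 'rV[C]_n => (u *m P^t*) 0 i) vE.
  rewrite /udiag -!mulmxA unitary_mul_trmxC mulmx1 mulmxA mul_mx_diag mxE.
  rewrite -scalemxAl !mxE => /eqP; rewrite mulrC -subr_eq0 -mulrBl mulf_eq0.
  by rewrite subr_eq0 mxE in wi *; rewrite (negbTE wi) orbF => /eqP.
exists (row i P).
  rewrite /udiag -row_mul !mulmxA unitary_mul_trmxC mul1mx.
  by apply/rowP => j; rewrite mxE diag_realmx_mul !mxE.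
(* This row is nonzero because the diagonal entry of [P P^*] is [1]. *)
apply/eqP => r0; have := congr1 (fun A : 'M[C]_n => A i i) unitary_mul_trmxC.
have := congr1 (fun u : 'rV[C]_n => (u *m P^t*) 0 i) r0.
by rewrite mul0mx -row_mul !mxE eqxx => -> /eqP; rewrite eq_sym oner_eq0.
Qed.

Lemma udiag_exp d m : udiag P d ^+ m = udiag P (fun i => d i ^+ m).
Proof.
elim: m => [|m IH].
  rewrite expr0 /udiag.
  suff -> : diag_mx (\row_i (d i ^+ 0)%:C) = 1%:M :> 'M[C]_n.
    by rewrite mulmx1 unitary_trmxC_mul.
  by apply/matrixP => i j; rewrite !mxE; case: (i == j).
rewrite exprS IH -mulmxE udiag_mul.
by under [in RHS]eq_fun do rewrite exprS.
Qed.

Lemma eulermx_udiag d k :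
  eulermx (udiag P d) k = udiag P (fun i => (1 + d i * k.+1%:R^-1) ^+ k.+1).
Proof.
rewrite -udiag_exp /eulermx.
suff -> : 1 + k.+1%:R^-1 *: udiag P d = udiag P (fun i => 1 + d i * k.+1%:R^-1) by [].
have diagE : diag_mx (\row_i (1 + d i * k.+1%:R^-1)%:C) =
    1%:M + k.+1%:R^-1 *: diag_mx (\row_i (d i)%:C) :> 'M[C]_n.
  apply/matrixP => i j; rewrite !mxE.
  case: (i == j); last by rewrite !mulr0n mulr0 addr0.
  by rewrite !mulr1n rmorphD rmorphM fmorphV rmorph_nat mulrC.
rewrite /udiag diagE mulmxDr mulmxDl mulmx1 unitary_trmxC_mul //.
rewrite -scalemxAr -scalemxAl; exact: erefl.
Qed.

(** The Euler products are diagonal in the same basis, with the real Euler products of the [d i] as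
    eigenvalues; limits are unique. *)
Lemma expm_udiag d : expm (udiag P d) = udiag P (fun i => expR (d i)).
Proof.
apply: cvgmx_unique (cvgmx_expm _) _.
have -> : eulermx (udiag P d) =
    (fun k => udiag P (fun i => (1 + d i * k.+1%:R^-1) ^+ k.+1)).
  by apply/funext => k; rewrite eulermx_udiag.
apply: cvgmx_mul; last exact: cvgmx_cst.
apply: cvgmx_mul; first exact: cvgmx_cst.
move=> i j; rewrite !mxE; under eq_fun do rewrite !mxE.
case: (i == j); last exact: cvgC_cst.
exact/cvgC_real/cvg_exp_euler_real.
Qed.

Lemma det_udiag d : \det (udiag P d) = (\prod_i d i)%:C.
Proof.
rewrite /udiag !det_mulmx mulrAC -det_mulmx unitary_trmxC_mul // det1 mul1r.
by rewrite det_diag rmorph_prod; apply: eq_bigr => i _; rewrite mxE.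
Qed.

Lemma mxtrace_udiag d : \tr (udiag P d) = (\sum_i d i)%:C.
Proof.
rewrite /udiag -mulmxA mxtrace_mulC -mulmxA unitary_mul_trmxC mulmx1.
by rewrite mxtrace_diag rmorph_sum; apply: eq_bigr => i _; rewrite mxE.
Qed.

End Fixed.

Lemma frobenius_sqr n (X : 'M[C]_n) :
  frobenius_norm X ^+ 2 = \sum_i \sum_j normc (X i j) ^+ 2.
Proof.
by rewrite sqr_sqrtr //; do 2 (apply: sumr_ge0 => ? _); exact: sqr_ge0.
Qed.

Lemma frobenius_ge0 n (X : 'M[C]_n) : 0 <= frobenius_norm X.
Proof. exact: sqrtr_ge0. Qed.

Lemma frobenius_sqr_tr n (X : 'M[C]_n) :
  frobenius_norm X ^+ 2 = Re (\tr (X *m X^t*)).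
Proof.
rewrite frobenius_sqr Re_sum; apply: eq_bigr => i _; rewrite mxE Re_sum.
apply: eq_bigr => j _; rewrite !mxE normc_sqr ReM.
by case: (X i j) => a b /=; rewrite mulrN opprK !expr2.
Qed.

Lemma frobenius_udiag n (P : 'M[C]_n) d : P \is unitarymx ->
  frobenius_norm (udiag P d) ^+ 2 = \sum_i d i ^+ 2.
Proof.
by move=> Pu; rewrite frobenius_sqr_tr udiag_hermitian udiag_mul // mxtrace_udiag.
Qed.

End UnitaryDiagonalization.

(** * The principal logarithm of a positive definite matrix *)

Section PrincipalLogarithm.
Variable R : realType.
Local Notation C := R[i].
Local Notation Im := (@complex.Im R).

(** The matrix [F] of [X] restricted to the row space of [W] has an eigenvector, the field being
    algebraically closed; [row_base] carries it back. *)
Lemma stable_eigenvector n (W X : 'M[C]_n) :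
  (W *m X <= W)%MS -> W != 0 ->
  exists a (w : 'rV[C]_n), [/\ w != 0, (w <= W)%MS & w *m X = a *: w].
Proof.
rewrite -stablemx_row_base => /submxP[F FE] W0.
have rW : (0 < \rank W)%N by rewrite lt0n mxrank_eq0.
have [a /eigenvalueP[v vE v0]] := eigenvalue_closed F rW.
exists a, (v *m row_base W); split.
- by rewrite mulmx_free_eq0 ?row_base_free.
- by rewrite mulmx_sub // eq_row_base.
- by rewrite -mulmxA FE mulmxA vE scalemxAl.
Qed.

Lemma eulermx_comm n (X : 'M[C]_n) k : eulermx X k *m X = X *m eulermx X k.
Proof.
have XY : GRing.comm X (1 + k.+1%:R^-1 *: X).
  apply: commrD; first exact: commr1.
  by rewrite /GRing.comm -!mulmxE -scalemxAl -scalemxAr.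
by rewrite !mulmxE; exact/esym/(commrX k.+1 XY).
Qed.

Lemma expm_comm n (X : 'M[C]_n) : expm X *m X = X *m expm X.
Proof.
apply: (@cvgmx_unique _ _ _ (fun k => eulermx X k *m X)).
  by apply: cvgmx_mul; [exact: cvgmx_expm|exact: cvgmx_cst].
under eq_fun do rewrite eulermx_comm.
by apply: cvgmx_mul; [exact: cvgmx_cst|exact: cvgmx_expm].
Qed.

(** The limit is also [e^x (cos y + i sin y)] for [a = x + i y]. It is real, so [sin y = 0], and the
    strip leaves only [y = 0]. *)
Lemma real_log_of_exp (a : C) (h : R) : 0 < h -> - pi < Im a < pi ->
  cvgC (fun k => (1 + k.+1%:R^-1 * a) ^+ k.+1) h%:C -> a = (ln h)%:C.
Proof.
case: a => x y h0 /= /andP[y_lo y_hi] lim.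
have [cosE sinE] : expR x * cos y = h /\ expR x * sin y = 0.
  have := cvgC_unique (cvgC_exp (x +i* y)) lim => /=; simpc.
  by case.
have sin0 : sin y = 0.
  by move/eqP: sinE; rewrite mulf_eq0 expR_eq0 /= => /eqP.
have y0 : y = 0.
  case: (ltgtP y 0) => // [y_neg|y_pos].
    have : 0 < sin (- y) by apply: sin_gt0_pi; rewrite oppr_gt0 y_neg ltrNl.
    by rewrite sinN sin0 oppr0 ltxx.
  have : 0 < sin y by apply: sin_gt0_pi; rewrite y_pos.
  by rewrite sin0 ltxx.
by rewrite y0 -cosE y0 cos0 mulr1 expRK.
Qed.

(** The divided difference at [a] and [l] of [z |-> (1 + z / (k + 1)) ^ (k + 1)], written as a sum
    so that it makes sense for [a = l] too. *)
Definition euler_quotient (l : C) k (a : C) : C :=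
  k.+1%:R^-1 * \sum_(i < k.+1) (1 + k.+1%:R^-1 * a) ^+ (k - i) *
    (1 + k.+1%:R^-1 * l) ^+ i.

Lemma euler_quotientE l k a :
  (1 + k.+1%:R^-1 * a) ^+ k.+1 - (1 + k.+1%:R^-1 * l) ^+ k.+1 =
  (a - l) * euler_quotient l k a.
Proof.
rewrite subrXX /euler_quotient mulrA; congr (_ * _).
by rewrite opprD addrACA subrr add0r -mulrBr mulrC.
Qed.

Definition euler_quotientmx n (l : C) k (X : 'M[C]_n) : 'M[C]_n :=
  k.+1%:R^-1 *: \sum_(i < k.+1) (1 + k.+1%:R^-1 *: X) ^+ (k - i) *m
    (1 + k.+1%:R^-1 * l)%:M ^+ i.

Lemma scalar_mx_exp n (c : C) j : (c%:M : 'M[C]_n) ^+ j = (c ^+ j)%:M.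
Proof.
elim: j => [|j IH]; first by rewrite !expr0.
by rewrite !exprS IH -mulmxE -scalar_mxM.
Qed.

Lemma euler_quotientmxE n (X : 'M[C]_n) l k :
  eulermx X k - ((1 + k.+1%:R^-1 * l) ^+ k.+1)%:M =
  (X - l%:M) *m euler_quotientmx l k X.
Proof.
have -> : ((1 + k.+1%:R^-1 * l) ^+ k.+1)%:M = ((1 + k.+1%:R^-1 * l)%:M) ^+ k.+1
  :> 'M[C]_n by rewrite scalar_mx_exp.
rewrite /eulermx subrXX_comm; last first.
  by rewrite /GRing.comm -mulmxE scalar_mxC.
rewrite -mulmxE /euler_quotientmx -scalemxAr scalemxAl; congr (_ *m _).
rewrite scalerBr scale_scalar_mx raddfD /= opprD addrACA.
by rewrite -[1%:M]/(1 : 'M[C]_n) subrr add0r.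
Qed.

Lemma euler_quotient_eigen n (X : 'M[C]_n) l k (a : C) (w : 'rV[C]_n) :
  w *m X = a *: w ->
  w *m euler_quotientmx l k X = euler_quotient l k a *: w.
Proof.
move=> wX.
have pow j : w *m (1 + k.+1%:R^-1 *: X) ^+ j = (1 + k.+1%:R^-1 * a) ^+ j *: w.
  elim: j => [|j IH]; first by rewrite !expr0 mulmx1 scale1r.
  rewrite exprSr -mulmxE mulmxA IH -scalemxAl mulmxDr mulmx1 -scalemxAr wX.
  by rewrite scalerA -{1}(scale1r w) -scalerDl scalerA exprSr.
rewrite -scalemxAr mulmx_sumr -scalerA scaler_suml; congr (_ *: _).
apply: eq_bigr => i _; rewrite mulmxA pow scalar_mx_exp mul_mx_scalar scalerA.
by rewrite mulrC.
Qed.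

(* On the eigenspace [E] of [expm X] for [h], the matrix [X - ln h] vanishes:
   otherwise its image contains an eigenvector [w] of [X], and dividing
   [exp X - h] by [X - ln h] shows that the divided difference of [exp] at
   the eigenvalue of [w] and [ln h] is zero, whereas it is [h] if these coincide,
   and [exp] is injective on the strip [|Im| < pi] otherwise. *)
Lemma principal_log_eigenspace n (X : 'M[C]_n) (h : R) : 0 < h ->
  (forall a, eigenvalue X a -> - pi < Im a < pi) ->
  eigenspace (expm X) h%:C *m (X - (ln h)%:C%:M) = 0.
Proof.
move=> h0 Xpi; set E := eigenspace _ _; set l := (ln h)%:C.
apply/eqP/negPn/negP => W0.
have EX : (E *m X <= E)%MS by apply: comm_mx_stable_eigenspace; exact: expm_comm.
have WX : (E *m (X - l%:M) *m X <= E *m (X - l%:M))%MS.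
  have -> : E *m (X - l%:M) *m X = E *m X *m (X - l%:M).
    have comm : (X - l%:M) *m X = X *m (X - l%:M).
      by rewrite mulmxBl mulmxBr scalar_mxC.
    by rewrite -(mulmxA E) comm mulmxA.
  exact: submxMr.
have [a [w [w0 wW wX]]] := stable_eigenvector WX W0.
have a_pi : - pi < Im a < pi by apply: Xpi; apply/eigenvalueP; exists w.
have [u uE] := submxP wW.
have uh : u *m E *m expm X = h%:C *: (u *m E).
  by apply/eigenspaceP; rewrite submxMl.
have expl : cvgC (fun k => (1 + k.+1%:R^-1 * l) ^+ k.+1) h%:C.
  have := cvgC_exp l; rewrite /l /= sin0 cos0 lnK ?posrE // => lim.
  by have -> : h%:C = h%:C * (1 +i* 0) by simpc.
have quot0 : cvgC (fun k => euler_quotient l k a) 0.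
  have lim : cvgmx (fun k => euler_quotient l k a *: w) 0.
    have -> : (fun k => euler_quotient l k a *: w) = (fun k =>
        u *m E *m (eulermx X k - ((1 + k.+1%:R^-1 * l) ^+ k.+1)%:M)).
      apply/funext => k; rewrite euler_quotientmxE mulmxA.
      by rewrite -(euler_quotient_eigen _ _ wX) uE !mulmxA.
    have -> : 0 = u *m E *m (expm X - h%:C%:M).
      by rewrite mulmxBr uh mul_mx_scalar subrr.
    apply: cvgmx_mul; first exact: cvgmx_cst.
    move=> i j; rewrite !mxE; under eq_fun do rewrite !mxE.
    apply: cvgCD; first exact: cvgmx_expm.
    apply: cvgCN; case: (i == j); [exact: expl|exact: cvgC_cst].
  have /rV0Pn[j wj] := w0.
  have := cvgCM (lim 0 j) (cvgC_cst (w 0 j)^-1).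
  rewrite mxE mul0r; under eq_fun do rewrite mxE mulfK //.
  by [].
have aE : a = l.
  apply: (real_log_of_exp h0 a_pi).
  have := cvgCD (cvgCM (cvgC_cst (a - l)) quot0) expl; rewrite mulr0 add0r.
  by under eq_fun do rewrite -euler_quotientE subrK.
(* For [a = l] the quotient is [(1 + l / (k + 1)) ^ k], one factor short of the Euler product; the
   missing factor tends to [1]. *)
have hE : cvgC (fun k => (1 + k.+1%:R^-1 * l) * euler_quotient l k a) 0.
  have := cvgCM (cvgCD (cvgC_cst 1) (cvgCM (cvgC_harmonic R) (cvgC_cst l))) quot0.
  by rewrite mulr0.
suff : h%:C = 0 :> C by case => h00; rewrite h00 ltxx in h0.
apply: cvgC_unique expl _.
suff eqf : (fun k => (1 + k.+1%:R^-1 * l) ^+ k.+1) =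
  (fun k => (1 + k.+1%:R^-1 * l) * euler_quotient l k a) by rewrite eqf.
apply/funext => k; rewrite aE /euler_quotient.
rewrite (eq_bigr (fun=> (1 + k.+1%:R^-1 * l) ^+ k)); last first.
  by move=> i _; rewrite -exprD subnK // -ltnS.
rewrite sumr_const card_ord -(mulr_natl (_ ^+ _)).
rewrite [k.+1%:R^-1 * (_ * _)]mulrA.
by rewrite mulVf ?pnatr_eq0 // mul1r exprS.
Qed.

(** Row [i] of [P] lies in the eigenspace of [expm X] for [h i], on which [X] acts as [ln (h i)];
    the rows of [P] form a basis. *)
Lemma principal_log_unique n (P X : 'M[C]_n) (h : 'I_n -> R) :
  P \is unitarymx -> (forall i, 0 < h i) ->
  principal_logarithms (udiag P h) X -> X = udiag P (fun i => ln (h i)).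
Proof.
move=> Pu h0 [expX Xpi].
suff PX : P *m X = diag_mx (\row_i (ln (h i))%:C) *m P.
  by rewrite /udiag -mulmxA -PX mulmxA unitary_trmxC_mul // mul1mx.
apply/row_matrixP => i; rewrite row_mul.
have rowE : (row i P <= eigenspace (expm X) (h i)%:C)%MS.
  apply/eigenspaceP; rewrite expX /udiag -row_mul !mulmxA.
  rewrite unitary_mul_trmxC // mul1mx.
  by apply/rowP => j; rewrite mxE diag_realmx_mul !mxE.
have [u uE] := submxP rowE.
have := principal_log_eigenspace (h0 i) Xpi.
move=> /(congr1 (mulmx u)); rewrite mulmx0 mulmxA -uE mulmxBr => /eqP.
rewrite subr_eq0 => /eqP ->; apply/rowP => j.
by rewrite mul_mx_scalar [RHS]mxE diag_realmx_mul !mxE.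
Qed.

Lemma udiag_logarithm n (P : 'M[C]_n) (h : 'I_n -> R) :
  P \is unitarymx -> (forall i, 0 < h i) ->
  expm (udiag P (fun i => ln (h i))) = udiag P h.
Proof.
move=> Pu h0; rewrite (expm_udiag Pu).
suff -> : (fun i => expR (ln (h i))) = h by exact: erefl.
by apply/funext => i; rewrite lnK // posrE.
Qed.

(** The diagonal logarithm has real eigenvalues, so it is principal and [xget] does not return its
    default; uniqueness then identifies the chosen value. *)
Lemma logm_udiag n (P : 'M[C]_n) (h : 'I_n -> R) :
  P \is unitarymx -> (forall i, 0 < h i) ->
  logm (udiag P h) = udiag P (fun i => ln (h i)).
Proof.
move=> Pu h0; apply: principal_log_unique => //; apply: xgetPex.
exists (udiag P (fun i => ln (h i))); split; first exact: udiag_logarithm.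
move=> a /eigenvalue_udiagP -/(_ Pu)[i ->] /=.
by rewrite oppr_lt0 pi_gt0.
Qed.

End PrincipalLogarithm.

(** * Spectral norm, Cauchy-Schwarz and the determinant of [exp X] *)

(** The one-matrix case of simultaneous triangularization of a commuting family. *)
Lemma schur_triangularization (C : numClosedFieldType) n (X : 'M[C]_n) :
  exists2 P : 'M[C]_n, P \is unitarymx & is_trig_mx (P *m X *m P^t*).
Proof.
have [|P Pu] := @cotrigonalization _ n [:: X].
  by move=> A B; rewrite !inE => /eqP -> /eqP ->.
by move=> /andP[trig _]; exists P => //; rewrite -conjymx.
Qed.

Section Norms.
Variable R : realType.
Local Notation C := R[i].
Local Notation Re := (@complex.Re R).
Local Notation Im := (@complex.Im R).
Local Notation normc := (@ComplexField.Normc.normc R).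

Lemma sqn_gram n (X : 'M[C]_n) (v : 'cV[C]_n) :
  rdot v (X^t* *m X *m v) = sqn (X *m v).
Proof. by rewrite -mulmxA -rdot_adjoint. Qed.

Lemma gram_udiag n (X : 'M[C]_n) :
  exists P d, [/\ P \is unitarymx, X^t* *m X = udiag P d & forall i, 0 <= d i].
Proof.
have [P [d [Pu XE]]] : exists P d, P \is unitarymx /\ X^t* *m X = udiag P d.
  by apply: hermitian_udiag; rewrite trmxC_mul trmxCK.
exists P, d; split => // i.
have := sqn_gram X (eigencol P i).
rewrite XE udiag_eigencol // rdotZr -/(sqn _) sqn_eigencol // mulr1 => ->.
exact: sqn_ge0.
Qed.

Lemma spectral_norm_ub n (X : 'M[C]_n) : ubound (singular_values X) (spectral_norm X).
Proof.
have [P [d [Pu XE d0]]] := gram_udiag X.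
suff ub : has_ubound (singular_values X) by move=> s Xs; exact: ub_le_sup.
(* A crude bound free of square roots: [s <= 1 + s^2], and [s^2] is one of the [d i]. *)
exists (1 + \sum_i d i) => s [s0].
rewrite XE => /eigenvalue_udiagP -/(_ Pu)[i /complexI sE].
apply: (@le_trans _ _ (1 + s ^+ 2)); first nra.
by rewrite lerD2l sE (bigD1 i) //= lerDl sumr_ge0.
Qed.

Lemma sqn_le_spectral_norm n (X : 'M[C]_n) (v : 'cV[C]_n) :
  sqn (X *m v) <= spectral_norm X ^+ 2 * sqn v.
Proof.
have [P [d [Pu XE d0]]] := gram_udiag X.
rewrite -sqn_gram XE rdot_udiag // -(sqn_unitary v Pu) sqnE mulr_sumr.
apply: ler_sum => i _; rewrite ler_wpM2r ?sqr_ge0 // -[d i]sqr_sqrtr //.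
have le : Num.sqrt (d i) <= spectral_norm X.
  apply: spectral_norm_ub; split; first exact: sqrtr_ge0.
  by rewrite sqr_sqrtr // XE; apply/eigenvalue_udiagP => //; exists i.
by rewrite lerXn2r // nnegrE ?sqrtr_ge0 // (le_trans _ le) ?sqrtr_ge0.
Qed.

Lemma spectral_norm_le n (X : 'M[C]_n) (c : R) : 0 <= c ->
  (forall v : 'cV[C]_n, sqn (X *m v) <= c ^+ 2 * sqn v) -> spectral_norm X <= c.
Proof.
move=> c0 Xc; have [P [d [Pu XE d0]]] := gram_udiag X.
have ub : ubound (singular_values X) c.
  move=> s [s0]; rewrite XE => /eigenvalue_udiagP -/(_ Pu)[i /complexI sE].
  rewrite -(ler_pXn2r (ltn0Sn 1)) ?nnegrE // sE.
  have := Xc (eigencol P i); rewrite -sqn_gram XE udiag_eigencol // rdotZr.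
  by rewrite -/(sqn _) sqn_eigencol // !mulr1.
(* For [n = 0] there is no singular value, and [sup] of the empty set is [0]. *)
have [X0|/set0P X0] := eqVneq (singular_values X) set0.
  by rewrite /spectral_norm X0 sup0.
exact: ge_sup.
Qed.

Lemma spectral_norm_ge0 n (X : 'M[C]_n) : 0 <= spectral_norm X.
Proof.
have [X0|/set0P[s Xs]] := eqVneq (singular_values X) set0.
  by rewrite /spectral_norm X0 sup0.
by apply: le_trans (spectral_norm_ub Xs); case: Xs.
Qed.

Lemma spectral_norm_udiag_le n (P : 'M[C]_n) d c : P \is unitarymx -> 0 <= c ->
  (forall i, `|d i| <= c) -> spectral_norm (udiag P d) <= c.
Proof.
move=> Pu c0 dc; apply: spectral_norm_le => // v.
rewrite sqn_udiag // -(sqn_unitary v Pu) sqnE mulr_sumr.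
apply: ler_sum => i _; rewrite ler_wpM2r ?sqr_ge0 //.
by rewrite -real_normK ?num_real // lerXn2r ?nnegrE.
Qed.

(** Cauchy-Schwarz: expand [|c v + t X v|^2 >= 0] for [t = 1] and [t = -1], then divide by [c],
    whence the separate case [c = 0]. *)
Lemma rdot_abs_le n (X : 'M[C]_n) (c : R) (v : 'cV[C]_n) : 0 <= c ->
  sqn (X *m v) <= c ^+ 2 * sqn v -> `|rdot v (X *m v)| <= c * sqn v.
Proof.
move=> c0 Xc.
have key (t : R) : t ^+ 2 = 1 ->
    0 <= c ^+ 2 * sqn v + 2 * t * c * rdot v (X *m v) + sqn (X *m v).
  move=> t1; have := sqn_ge0 (c%:C *: v + t%:C *: (X *m v)).
  rewrite /sqn !rdotDl !rdotDr !rdotZl !rdotZr (rdotC (X *m v) v).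
  have -> : t * (t * rdot (X *m v) (X *m v)) = rdot (X *m v) (X *m v).
    by rewrite mulrA -expr2 t1 mul1r.
  by congr (_ <= _); ring.
have [c_eq0|c_neq0] := eqVneq c 0.
  have Xv0 : X *m v = 0.
    apply/eqP/negPn/negP => /sqn_gt0; rewrite ltNge.
    by move: Xc; rewrite c_eq0 expr0n mul0r => ->.
  by rewrite Xv0 c_eq0 mul0r /rdot big1 ?normr0 // => i _; rewrite mxE /= !mulr0 addr0.
have c_gt0 : 0 < c by rewrite lt_def c_neq0.
have := key 1; rewrite expr1n => /(_ erefl) k1.
have := key (-1); rewrite sqrrN expr1n => /(_ erefl) k2.
rewrite ler_norml -(ler_pM2l c_gt0) -[X in _ && X](ler_pM2l c_gt0).
by apply/andP; split; nra.
Qed.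

(** After Schur triangularization, the determinant of an Euler product is the product of the scalar
    Euler products of the diagonal entries of [T]; each limit has modulus [expR] of the real
    part. *)
Lemma normc_det_expm n (X : 'M[C]_n) :
  normc (\det (expm X)) = expR (Re (\tr X)).
Proof.
have [P Pu] := schur_triangularization X.
move TE : (P *m X *m P^t*) => T Ttrig; have /is_trig_mxP Tij := Ttrig.
have detE k : \det (eulermx X k) = \prod_i (1 + k.+1%:R^-1 * T i i) ^+ k.+1.
  have det1E : \det (1 + k.+1%:R^-1 *: X) = \prod_i (1 + k.+1%:R^-1 * T i i).
    have -> : \det (1 + k.+1%:R^-1 *: X) = \det (1%:M + k.+1%:R^-1 *: T).
      have -> : 1%:M + k.+1%:R^-1 *: T = P *m (1 + k.+1%:R^-1 *: X) *m P^t*.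
        rewrite mulmxDr mulmxDl mulmx1 unitary_mul_trmxC // -scalemxAr -scalemxAl.
        by rewrite TE.
      by rewrite !det_mulmx mulrAC -det_mulmx unitary_mul_trmxC // det1 mul1r.
    rewrite det_trig; last first.
      apply/is_trig_mxP => i j ij; rewrite !mxE Tij // mulr0 addr0.
      by rewrite -val_eqE (ltn_eqF ij).
    by apply: eq_bigr => i _; rewrite !mxE eqxx.
  have detX m (A : 'M[C]_n) : \det (A ^+ m) = \det A ^+ m.
    elim: m => [|m IH]; first by rewrite !expr0 det1.
    by rewrite !exprS -mulmxE det_mulmx IH.
  by rewrite detX det1E prodrXl.
have lim := cvgC_det (cvgmx_expm X).
have lim' : cvgC (fun k => \det (eulermx X k))
    (\prod_i ((expR (Re (T i i)))%:C * (cos (Im (T i i)) +i* sin (Im (T i i))))).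
  under eq_fun do rewrite detE.
  by apply: cvgC_prod => i; exact: cvgC_exp.
have -> : \tr X = \tr T.
  by rewrite -TE mxtrace_mulC mulmxA unitary_trmxC_mul // mul1mx.
rewrite (cvgC_unique lim lim') Re_sum expR_sum.
rewrite (big_morph normc (@ComplexField.Normc.normcM R) (@ComplexField.Normc.normc1 R)).
apply: eq_bigr => i _; rewrite ComplexField.Normc.normcM normc_real.
by rewrite ger0_norm ?expR_ge0 // /= cos2Dsin2 sqrtr1 mulr1.
Qed.

End Norms.

(** * Majorization for at most three reals *)

Section SumOfSquares.
Variable R : realType.

(** Sorting that retains only symmetric data: the sum, the sum of squares, and the upper and lower
    bounds. The equivalences on [c] carry the hull hypotheses over to sorted triples. *)
Lemma sort3 (x1 x2 x3 : R) : exists y1 y2 y3, [/\ y1 <= y2, y2 <= y3,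
  y1 + y2 + y3 = x1 + x2 + x3,
  y1 ^+ 2 + y2 ^+ 2 + y3 ^+ 2 = x1 ^+ 2 + x2 ^+ 2 + x3 ^+ 2 &
  (forall c, y3 <= c <-> [/\ x1 <= c, x2 <= c & x3 <= c]) /\
  (forall c, c <= y1 <-> [/\ c <= x1, c <= x2 & c <= x3])].
Proof.
(* Membership of [y1] and [y3] in the list turns bounds on all the [x] into bounds on these two. *)
have intro y1 y2 y3 : y1 <= y2 -> y2 <= y3 ->
  y1 + y2 + y3 = x1 + x2 + x3 ->
  y1 ^+ 2 + y2 ^+ 2 + y3 ^+ 2 = x1 ^+ 2 + x2 ^+ 2 + x3 ^+ 2 ->
  [/\ y1 <= x1, y1 <= x2 & y1 <= x3] -> [/\ x1 <= y3, x2 <= y3 & x3 <= y3] ->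
  y1 \in [:: x1; x2; x3] -> y3 \in [:: x1; x2; x3] -> exists y1 y2 y3,
  [/\ y1 <= y2, y2 <= y3, y1 + y2 + y3 = x1 + x2 + x3,
  y1 ^+ 2 + y2 ^+ 2 + y3 ^+ 2 = x1 ^+ 2 + x2 ^+ 2 + x3 ^+ 2 &
  (forall c, y3 <= c <-> [/\ x1 <= c, x2 <= c & x3 <= c]) /\
  (forall c, c <= y1 <-> [/\ c <= x1, c <= x2 & c <= x3])].
  move=> y12 y23 sum sqr [lo1 lo2 lo3] [hi1 hi2 hi3]; rewrite !inE => y1x y3x.
  exists y1, y2, y3; split => //; split => c; split.
  - by move=> ?; split; lra.
  - by case=> c1 c2 c3; move: y3x => /or3P[] /eqP ->.
  - by move=> ?; split; lra.
  - by case=> c1 c2 c3; move: y1x => /or3P[] /eqP ->.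
(* With strict inequalities weakened, two of the eight patterns are cyclic; they force
   [x1 = x2 = x3], and any order serves there. *)
case: (leP x1 x2) => [|/ltW] x12; case: (leP x2 x3) => [|/ltW] x23;
  case: (leP x1 x3) => [|/ltW] x13.
- by apply: (intro x1 x2 x3); rewrite ?inE ?eqxx ?orbT //; split; lra.
- by apply: (intro x1 x2 x3); rewrite ?inE ?eqxx ?orbT //; try split; lra.
- by apply: (intro x1 x3 x2); rewrite ?inE ?eqxx ?orbT //; try split; lra.
- by apply: (intro x3 x1 x2); rewrite ?inE ?eqxx ?orbT //; try split; lra.
- by apply: (intro x2 x1 x3); rewrite ?inE ?eqxx ?orbT //; try split; lra.
- by apply: (intro x2 x3 x1); rewrite ?inE ?eqxx ?orbT //; try split; lra.
- by apply: (intro x3 x2 x1); rewrite ?inE ?eqxx ?orbT //; try split; lra.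
- by apply: (intro x3 x2 x1); rewrite ?inE ?eqxx ?orbT //; try split; lra.
Qed.

(* Abel summation: with [d = b - a],
   [sum (b^2 - a^2) >= 2 sum d a = 2 (a1 - a2) d1 + 2 (a2 - a3) (d1 + d2)]. *)
Lemma sum_sqr_le_sorted (a1 a2 a3 b1 b2 b3 : R) : a1 <= a2 -> a2 <= a3 ->
  b1 <= a1 -> a3 <= b3 -> a1 + a2 + a3 = b1 + b2 + b3 ->
  a1 ^+ 2 + a2 ^+ 2 + a3 ^+ 2 <= b1 ^+ 2 + b2 ^+ 2 + b3 ^+ 2.
Proof.
move=> a12 a23 ba1 ab3 sum.
have p1 : 0 <= (a2 - a1) * (a1 - b1) by rewrite mulr_ge0 ?subr_ge0.
have p2 : 0 <= (a3 - a2) * (b3 - a3) by rewrite mulr_ge0 ?subr_ge0.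
have b2E : b2 = a1 + a2 + a3 - b1 - b3 by lra.
rewrite -subr_ge0.
have -> : b1 ^+ 2 + b2 ^+ 2 + b3 ^+ 2 - (a1 ^+ 2 + a2 ^+ 2 + a3 ^+ 2) =
  (b1 - a1) ^+ 2 + (b2 - a2) ^+ 2 + (b3 - a3) ^+ 2 +
  2 * ((a2 - a1) * (a1 - b1)) + 2 * ((a3 - a2) * (b3 - a3)).
  by rewrite b2E; ring.
by rewrite !addr_ge0 ?sqr_ge0 ?mulr_ge0 ?subr_ge0.
Qed.

(** The last two hypotheses place each [a i] between the extremes of [b]. Quantifying over bounds
    [c] avoids choosing a maximum, and is the form in which bounds on the quadratic form of [X]
    yield bounds on the [ln (h i)]. *)
Lemma sum_sqr_le_hull n (a b : 'I_n -> R) : (n <= 3)%N ->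
  \sum_i a i = \sum_i b i ->
  (forall c, (forall j, b j <= c) -> forall i, a i <= c) ->
  (forall c, (forall j, c <= b j) -> forall i, c <= a i) ->
  \sum_i a i ^+ 2 <= \sum_i b i ^+ 2.
Proof.
case: n a b => [|[|[|[|//]]]] a b _;
  rewrite ?big_ord0 // !big_ord_recl !big_ord0 ?addr0.
- by move=> ->.
- set a1 := a _; set a2 := a _; set b1 := b _; set b2 := b _ => sum hi lo.
  have all2 (P : R -> Prop) (f : 'I_2 -> R) :
      P (f ord0) -> P (f (lift ord0 ord0)) -> forall j, P (f j).
    move=> P1 P2 j; case: (unliftP ord0 j) => [k ->|-> //].
    by rewrite [k]ord1.
  have hull m M : m <= b1 -> m <= b2 -> b1 <= M -> b2 <= M ->
      [/\ m <= a1, m <= a2, a1 <= M & a2 <= M].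
    move=> m1 m2 M1 M2; split.
    + exact/lo/(all2 (fun x => m <= x)).
    + exact/lo/(all2 (fun x => m <= x)).
    + exact/hi/(all2 (fun x => x <= M)).
    + exact/hi/(all2 (fun x => x <= M)).
  case: (leP b1 b2) => [|/ltW] b12.
    have [] := hull b1 b2 (lexx _) b12 b12 (lexx _) => ? ? ? ?; nra.
  have [] := hull b2 b1 b12 (lexx _) (lexx _) b12 => ? ? ? ?; nra.
- set a1 := a _; set a2 := a _; set a3 := a _.
  set b1 := b _; set b2 := b _; set b3 := b _; rewrite !addrA => sum hi lo.
  have all3 (P : R -> Prop) (f : 'I_3 -> R) : P (f ord0) ->
      P (f (lift ord0 ord0)) -> P (f (lift ord0 (lift ord0 ord0))) ->
      forall j, P (f j).
    move=> P1 P2 P3 j; case: (unliftP ord0 j) => [k ->|-> //].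
    by case: (unliftP ord0 k) => [l ->|-> //]; rewrite [l]ord1.
  have [x1 [x2 [x3 [x12 x23 xsum xsqr [xhi xlo]]]]] := sort3 a1 a2 a3.
  have [y1 [y2 [y3 [y12 y23 ysum ysqr [yhi ylo]]]]] := sort3 b1 b2 b3.
  rewrite -xsqr -ysqr; apply: sum_sqr_le_sorted => //; last by rewrite xsum sum ysum.
    have [l1 l2 l3] := (ylo y1).1 (lexx _).
    by apply/xlo; split; apply/lo/(all3 (fun x => y1 <= x)).
  have [l1 l2 l3] := (yhi y3).1 (lexx _).
  by apply/xhi; split; apply/hi/(all3 (fun x => x <= y3)).
Qed.
End SumOfSquares.

(** * Lower bounds for logarithms and attainment of the minima *)

Section Minimization.
Variable R : realType.
Local Notation C := R[i].
Local Notation Re := (@complex.Re R).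
Local Notation Im := (@complex.Im R).
Local Notation normc := (@ComplexField.Normc.normc R).

Lemma normc_det_unitary n (W : 'M[C]_n) : W \is unitarymx -> normc (\det W) = 1.
Proof.
move=> Wu; have detW : normc (\det (W^t*)) = normc (\det W).
  rewrite det_map_mx det_tr; case: (\det W) => x y.
  by rewrite /= sqrrN.
have := congr1 (fun A => normc (\det A)) (unitary_mul_trmxC Wu).
rewrite det_mulmx det1 ComplexField.Normc.normcM detW ComplexField.Normc.normc1.
rewrite -expr2 => /eqP; rewrite sqrf_eq1 => /orP[/eqP //|/eqP n1].
by have := normc_ge0 (\det W); rewrite n1 oppr_ge0 ler10.
Qed.

Lemma posdefmx_udiag n (H : 'M[C]_n) : posdefmx H ->
  exists P h, [/\ P \is unitarymx, H = udiag P h & forall i, 0 < h i].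
Proof.
move=> [Hherm Hpos].
have HC : H^t* = H.
  by have /is_hermitianmxP := Hherm; rewrite expr0 scale1r => {2}->.
have [P [h [Pu HE]]] := hermitian_udiag HC.
exists P, h; split => // i.
have v0 : eigencol P i != 0.
  apply/eqP => v0; have := sqn_eigencol Pu i.
  rewrite v0 /sqn /rdot big1 => [/esym/eqP|j _]; first by rewrite oner_eq0.
  by rewrite mxE /= !mulr0 addr0.
have := Hpos _ v0; rewrite ltcE /= => /andP[_].
rewrite -mulmxA -rdot_trmxC HE udiag_eigencol // rdotZr.
by rewrite -/(sqn _) sqn_eigencol // mulr1.
Qed.

Lemma trmxCE m n (A : 'M[C]_(m, n)) i j : (A^t*) i j = (A j i)^*.
Proof. by rewrite !mxE. Qed.

Lemma Re_sym_part n (X : 'M[C]_n) i j :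
  Re (sym_part X i j) = (Re (X i j) + Re (X j i)) / 2.
Proof.
rewrite /sym_part !(trmxCE, mxE).
have -> : (2^-1 : C) = (2^-1 : R)%:C by rewrite fmorphV rmorph_nat.
by case: (X i j) (X j i) => a b [c d] /=; rewrite mul0r subr0 mulrC addrC.
Qed.

Lemma Im_sym_part n (X : 'M[C]_n) i j :
  Im (sym_part X i j) = (Im (X i j) - Im (X j i)) / 2.
Proof.
rewrite /sym_part !(trmxCE, mxE).
have -> : (2^-1 : C) = (2^-1 : R)%:C by rewrite fmorphV rmorph_nat.
by case: (X i j) (X j i) => a b [c d] /=; rewrite mul0r addr0 mulrC addrC.
Qed.

Lemma udiag_sym_part n (P : 'M[C]_n) d : P \is unitarymx ->
  sym_part (udiag P d) = udiag P d.
Proof.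
move=> Pu; rewrite /sym_part udiag_hermitian // -mulr2n.
rewrite -(scaler_nat 2 (udiag P d)) scalerA.
by rewrite mulVf ?pnatr_eq0 // scale1r.
Qed.

Section Bounds.
Variables (n : nat) (P W X : 'M[C]_n) (h : 'I_n -> R).
Hypotheses (P_unitary : P \is unitarymx) (W_unitary : W \is unitarymx).
Hypothesis h_gt0 : forall i, 0 < h i.
(** The polar form of [exp X]: when [exp X = Q^* Z] and [Z = U H], the unitary factor is
    [W = Q^* U]. *)
Hypothesis expX : expm X = W *m udiag P h.

Lemma sqn_expm_eigencol i : sqn (expm X *m eigencol P i) = expR (2 * ln (h i)).
Proof.
rewrite expX -mulmxA sqn_unitary // udiag_eigencol // /sqn rdotZl rdotZr.
rewrite -/(sqn _) sqn_eigencol // mulr1 (mulrC 2) expRM_natr lnK ?posrE //.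
Qed.

(** Test the growth bound for [exp X] at the unit eigenvector of [udiag P h] for [h i], which
    [exp X] stretches by [h i]. The auxiliary bound on [|X u|^2] comes from the spectral norm. *)
Lemma ln_eigenvalue_le c i :
  (forall v : 'cV[C]_n, rdot v (X *m v) <= c * sqn v) -> ln (h i) <= c.
Proof.
move=> Xc; have := sqn_expm_le (eigencol P i) (sqr_ge0 _) (sqn_le_spectral_norm X) Xc.
by rewrite sqn_expm_eigencol sqn_eigencol // mulr1 ler_expR ler_pM2l.
Qed.

Lemma ln_eigenvalue_ge c i :
  (forall v : 'cV[C]_n, c * sqn v <= rdot v (X *m v)) -> c <= ln (h i).
Proof.
move=> Xc; have := sqn_expm_ge (eigencol P i) Xc.
by rewrite sqn_expm_eigencol sqn_eigencol // mulr1 ler_expR ler_pM2l.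
Qed.

(** Compare the moduli of the determinants in [expX]; that of [W] is [1]. *)
Lemma sum_ln_eigenvalue : \sum_i ln (h i) = Re (\tr X).
Proof.
apply: expR_inj; rewrite -normc_det_expm expX det_mulmx ComplexField.Normc.normcM.
rewrite normc_det_unitary // mul1r det_udiag // normc_real ger0_norm; last first.
  by apply: prodr_ge0 => i _; exact: ltW.
by rewrite expR_sum; apply: eq_bigr => i _; rewrite lnK ?posrE.
Qed.

(** Only the real quadratic form of [X] matters. Allowing any [Y] with the same form covers [X] and
    [sym_part X] at once. *)
Lemma spectral_norm_log_le (Y : 'M[C]_n) :
  (forall v : 'cV[C]_n, rdot v (X *m v) = rdot v (Y *m v)) ->
  spectral_norm (udiag P (fun i => ln (h i))) <= spectral_norm Y.
Proof.
move=> XY; have Y0 := spectral_norm_ge0 Y.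
have bound v : `|rdot v (X *m v)| <= spectral_norm Y * sqn v.
  by rewrite XY; apply: rdot_abs_le => //; exact: sqn_le_spectral_norm.
apply: spectral_norm_udiag_le => // i; rewrite ler_norml; apply/andP; split.
  apply: ln_eigenvalue_ge => v; rewrite mulNr.
  by have := bound v; rewrite ler_norml => /andP[].
apply: ln_eigenvalue_le => v.
by have := bound v; rewrite ler_norml => /andP[].
Qed.

(** Let [s] be the eigenvalues of [sym_part X]. Bounds on [s] bound the quadratic form of [X], hence
    the [ln (h i)]; the sums agree by the trace identity, so [sum_sqr_le_hull] applies. *)
Lemma frobenius_norm_log_le : (n <= 3)%N ->
  frobenius_norm (udiag P (fun i => ln (h i))) <= frobenius_norm (sym_part X).
Proof.
move=> n3; rewrite -(ler_pXn2r (ltn0Sn 1)) ?nnegrE ?frobenius_ge0 //.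
have symC : (sym_part X)^t* = sym_part X.
  rewrite /sym_part; apply/matrixP => i j; rewrite !(trmxCE, mxE).
  have -> : (2^-1 : C) = (2^-1 : R)%:C by rewrite fmorphV rmorph_nat.
  by case: (X i j) (X j i) => a b [c d] /=; congr (_ +i* _); ring.
have [V [s [Vu symE]]] := hermitian_udiag symC.
have rdotX v : rdot v (X *m v) = \sum_i s i * normc ((V *m v) i 0) ^+ 2.
  by rewrite -rdot_sym_part symE rdot_udiag.
rewrite symE !frobenius_udiag //; apply: sum_sqr_le_hull => // [|c sc i|c sc i].
- rewrite sum_ln_eigenvalue.
  have -> : Re (\tr X) = Re (\tr (sym_part X)).
    by rewrite !Re_sum; apply: eq_bigr => i _; rewrite Re_sym_part; field.
  by rewrite symE mxtrace_udiag.
- apply: ln_eigenvalue_le => v; rewrite rdotX -(sqn_unitary v Vu) sqnE mulr_sumr.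
  by apply: ler_sum => j _; rewrite ler_wpM2r ?sqr_ge0.
- apply: ln_eigenvalue_ge => v; rewrite rdotX -(sqn_unitary v Vu) sqnE mulr_sumr.
  by apply: ler_sum => j _; rewrite ler_wpM2r ?sqr_ge0.
Qed.
End Bounds.

(** Pair the entries [(i, j)] and [(j, i)]: the difference is then a sum of squares, the
    contribution of the skew-Hermitian part. *)
Lemma frobenius_sym_part_le n (X : 'M[C]_n) :
  frobenius_norm (sym_part X) <= frobenius_norm X.
Proof.
rewrite -(ler_pXn2r (ltn0Sn 1)) ?nnegrE ?frobenius_ge0 // !frobenius_sqr.
have -> : \sum_i \sum_j normc (X i j) ^+ 2 =
    \sum_i \sum_j (normc (X i j) ^+ 2 + normc (X j i) ^+ 2) / 2.
  under [RHS]eq_bigr do rewrite -mulr_suml big_split.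
  by rewrite -mulr_suml big_split /= [X in _ + X]exchange_big /=; field.
apply: ler_sum => i _; apply: ler_sum => j _.
rewrite !normc_sqr Re_sym_part Im_sym_part -subr_ge0.
set a := Re (X i j); set b := Im (X i j); set c := Re (X j i); set d := Im (X j i).
have -> : (a ^+ 2 + b ^+ 2 + (c ^+ 2 + d ^+ 2)) / 2 -
    (((a + c) / 2) ^+ 2 + ((b - d) / 2) ^+ 2) =
  ((a - c) / 2) ^+ 2 + ((b + d) / 2) ^+ 2 by field.
by rewrite addr_ge0 ?sqr_ge0.
Qed.

(** The part common to both norms. As [L] is Hermitian it equals its own [sym_part], so the pair
    [U], [L] attains both minima and only the lower bounds are left to each norm. *)
Lemma log_minimization_intro (norm : forall n, 'M[C]_n -> R) n
    (Z U H : 'M[C]_n) (P : 'M[C]_n) (h : 'I_n -> R) :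
  P \is unitarymx -> (forall i, 0 < h i) -> H = udiag P h ->
  U \is unitarymx -> Z = U *m H ->
  let L := udiag P (fun i => ln (h i)) in
  (forall W X, W \is unitarymx -> expm X = W *m udiag P h ->
     norm n L <= norm n X /\ norm n L <= norm n (sym_part X)) ->
  log_minimization (@norm n) Z U H.
Proof.
move=> Pu h0 HE Uu ZE L Lmin.
have UZ : U^t* *m Z = H by rewrite ZE mulmxA unitary_trmxC_mul // mul1mx.
have logH : logm H = L by rewrite HE logm_udiag.
have expL : expm L = H by rewrite HE udiag_logarithm.
have bound Q X : Q \is unitarymx -> expm X = Q^t* *m Z ->
    norm n L <= norm n X /\ norm n L <= norm n (sym_part X).
  move=> Qu expX; apply: (Lmin (Q^t* *m U)).
    by apply: (mul_unitarymx _ Uu); rewrite trmxC_unitary.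
  by rewrite expX ZE HE mulmxA.
rewrite /log_minimization UZ logH; split => //; split.
- by exists U, L; split => //; rewrite /logarithms UZ.
- by move=> r [Q [X [Qu expX ->]]]; case: (bound Q X).
- by exists U, L; split => //; rewrite /logarithms ?UZ ?udiag_sym_part.
- by move=> r [Q [X [Qu expX ->]]]; case: (bound Q X).
Qed.

End Minimization.

Theorem theorem1p1 (R : realType) (n : nat) (Z U H : 'M[R[i]]_n)
    (Z_nonsingular : Z \in unitmx) (Z_polar : polar_decomposition Z U H) :
  log_minimization (@spectral_norm R n) Z U H /\
  ((n <= 3)%N -> log_minimization (@frobenius_norm R n) Z U H).
Proof.
have [Uu /posdefmx_udiag[P [h [Pu HE h0]]] ZE] := Z_polar.
split=> [|n3].
  apply: (log_minimization_intro (norm := @spectral_norm R) Pu h0 HE Uu ZE).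
  (* The same bound is used with [Y = X] and with [Y = sym_part X]. *)
  move=> W X Wu expX; split; apply: (spectral_norm_log_le Pu Wu h0 expX) => // v.
  by rewrite rdot_sym_part.
apply: (log_minimization_intro (norm := @frobenius_norm R) Pu h0 HE Uu ZE).
move=> W X Wu expX; have le := frobenius_norm_log_le Pu Wu h0 expX n3.
by split => //; apply: le_trans le (frobenius_sym_part_le _).
Qed.
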